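(* Fix $\varepsilon>0$ and let $p\to\infty$ with $k=k(p)\le p^{6/5-\varepsilon}$. Let $w_1,\dots,w_k\in\mathbb{R}^p$ be drawn independently from $\mathcal{N}(0,I_p)$. Let $v_i=\pi_i w_i$, where each $\pi_i$ is a scalar random variable such that for every $\delta>0$, $|1/\pi_i^2-1|\le p^{-1/2+\delta}$ with very high probability. (The $\pi_i$ need not be identically distributed, nor independent of the $w_i$ or of each other.) Then with very high probability there exists a symmetric matrix $Y\succeq 0$ with $v_i^\top Y v_i=1$ for all $i\in[k]$ (i.e., an ellipsoid passing through $v_1,\dots,v_k$).
   Context: ''With very high probability'' means with probability converging to $1$ faster than any inverse polynomial in $p$, as $p\to\infty$. *)

(* Defs.v *)
From HB Require Import structures.
From mathcomp Require Import all_boot all_order all_algebra.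
From mathcomp Require Import all_classical all_reals all_analysis.
From mathcomp Require Import normal_distribution.
Set Implicit Arguments. Unset Strict Implicit. Unset Printing Implicit Defensive.
Import Order.TTheory GRing.Theory Num.Theory.
Local Open Scope classical_set_scope.
Local Open Scope ring_scope.

Definition std_normal_rv {R : realType} {d} {T : measurableType d}
  (P : probability T R) (X : T -> R) : Prop :=
  measurable_fun setT X /\
  forall B : set R, measurable B -> P (X @^-1` B) = normal_prob 0 1 B.

(* Mutual independence of a finite family of real random variables:
   product rule for all families of Borel sets (taking B j = setT covers
   every subfamily). *)
Definition mutually_independent {R : realType} {d} {T : measurableType d}
  (P : probability T R) (I : finType) (X : I -> T -> R) : Prop :=
  forall B : I -> set R, (forall j, measurable (B j)) ->
    P (\bigcap_(j in [set: I]) (X j @^-1` B j)) = (\prod_(j : I) P (X j @^-1` B j))%E.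

(* "E holds with probability at least q": some measurable event of
   probability >= q is contained in E (avoids measurability issues of E). *)
Definition holds_with_prob {R : realType} {d} {T : measurableType d}
  (P : probability T R) (E : set T) (q : R) : Prop :=
  exists A : set T, [/\ measurable A, A `<=` E & (q%:E <= P A)%E].

Definition psd {R : realType} (n : nat) (Y : 'M[R]_n) : Prop :=
  Y^T = Y /\ forall x : 'cV[R]_n, 0 <= (x^T *m Y *m x) 0 0.

(* Main.v *)
Require Import Defs.
From HB Require Import structures.
From mathcomp Require Import all_boot all_order all_algebra.
From mathcomp Require Import all_classical all_reals all_analysis.
From mathcomp Require Import normal_distribution measurable_realfun.
From mathcomp Require Import ring lra.
Set Implicit Arguments.
Unset Strict Implicit.
Unset Printing Implicit Defensive.
Import Order.TTheory GRing.Theory Num.Theory.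
Local Open Scope classical_set_scope.
Local Open Scope ring_scope.
Import numFieldNormedType.Exports.

(* Write r = p^(1/200), and split each w_i = a_i + b_i into its first p/2
   coordinates and the remaining ones.  We look for
     Y = (I + sum_i c_i (a_i b_i^T + b_i a_i^T) / 2) / p,
   so that w_l^T Y w_l = 1/pi_l^2 becomes the linear system G c = e with
   G_il = <a_i, a_l> <b_i, b_l> and e_l = p / pi_l^2 - |w_l|^2 = O(p^(1/2) r^2).

   - G is well conditioned.  Given the a's, the strictly triangular part of the
     form sum_il G_il u_i v_l is a martingale in the rows b_1, b_2, ..., whose
     conditional variance is controlled by the operator norm of the matrix W
     with rows w_i and by max |<a_i, a_l>|.  The exponential supermartingale
     and a union bound over a grid show that it is O(p^(3/2) r^46), negligible
     against the diagonal G_ii, of order p^2.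
   - Hence |c|_2 <= O(sqrt k |e|_oo / p^2), and reading G c = e row by row
     improves this to |c|_oo <= O(k p^(-5/2) r^4).
   - Therefore |x^T (p Y - I) x| <= |c|_oo |W|^2 |x|^2 / 2 with
     |W|^2 <= O(p^(6/5) r^6), and Y is positive semidefinite because
     k |W|^2 p^(-5/2) tends to 0 like p^(-1/10). *)

(** * Resampling one coordinate of an independent family *)

Definition upd {R : Type} {I : eqType} (w : I -> R) (a : I) (x : R) : I -> R :=
  fun b => if b == a then x else w b.

(** Boxes with a measurable side in every coordinate: they are stable under intersection, and mutual
    independence is exactly the product rule on them. *)
Definition cylinders (R : realType) (I : finType) : set (set (I -> R)) :=
  [set A | exists2 B : I -> set R, (forall i, measurable (B i)) &
     A = [set w | forall i, B i (w i)]].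
Arguments cylinders : clear implicits.

Definition cylType (R : realType) (I : finType) :
  measurableType (cylinders R I).-sigma := g_sigma_algebraType (cylinders R I).
Arguments cylType : clear implicits.

Lemma setI_closed_cylinders (R : realType) (I : finType) :
  setI_closed (cylinders R I).
Proof.
move=> _ _ [B mB ->] [C mC ->]; exists (fun i => B i `&` C i).
  by move=> i; exact: measurableI.
apply/seteqP; split => w /=.
  by move=> [Bw Cw] i; split; [exact: Bw|exact: Cw].
by move=> BC; split => i; case: (BC i).
Qed.

Lemma measurable_coord (R : realType) (I : finType) (i : I) :
  measurable_fun setT (fun w : cylType R I => (w : I -> R) i).
Proof.
move=> _ B mB; rewrite setTI; apply: sub_sigma_algebra.
exists (fun j => if j == i then B else setT).
  by move=> j; case: ifP => // _; exact: measurableT.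
apply/seteqP; split => w /=.
  by move=> Bw j; case: eqP => [->|].
by move=> /(_ i); rewrite eqxx.
Qed.

Lemma measurable_to_cyl d (T : measurableType d) (R : realType) (I : finType)
    (f : T -> cylType R I) :
  (forall i, measurable_fun setT (fun t => f t i)) -> measurable_fun setT f.
Proof.
move=> mf.
apply: (@measurability _ _ _ _ setT f (cylinders R I)) => //.
move=> _ [_ [B mB ->] <-].
rewrite setTI.
have -> : f @^-1` [set w | forall i, B i (w i)] =
    \bigcap_(i in [set: I]) ((fun t => f t i) @^-1` B i).
  apply/seteqP; split => t /=; first by move=> Bt i _; exact: Bt.
  by move=> Bt i; exact: Bt.
apply: fin_bigcap_measurable => // i _.
by rewrite -[X in measurable X]setTI; exact: mf.
Qed.

Lemma measurable_resample d (T : measurableType d) (R : realType)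
    (I : finType) (X : I -> T -> R) (a : I) :
  (forall i, measurable_fun setT (X i)) ->
  measurable_fun setT (fun tx : T * measurableTypeR R =>
    upd (fun i => X i tx.1) a tx.2 : cylType R I).
Proof.
move=> mX; apply: measurable_to_cyl => i; rewrite /upd; case: (i == a).
  exact: measurable_snd.
by apply: (measurableT_comp (mX i)); exact: measurable_fst.
Qed.

(* Both sides are integrals against the law of [X] on [I -> R]: replacing one
   coordinate by an independent copy does not change the probability of any
   cylinder, and the cylinders form a generating pi-system. *)
Lemma integral_resample d (T : measurableType d) (R : realType)
    (P : probability T R) (I : finType) (X : I -> T -> R)
    (nu : probability (measurableTypeR R) R) (a : I)
    (F : cylType R I -> \bar R) :
  (forall i, measurable_fun setT (X i)) ->
  mutually_independent P X ->
  (forall B : set R, measurable B -> P (X a @^-1` B) = nu B) ->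
  measurable_fun setT F -> (forall w, (0 <= F w)%E) ->
  (\int[P]_t F (fun i => X i t) =
   \int[P]_t \int[nu]_x F (upd (fun i => X i t) a x))%E.
Proof.
move=> mX iX lX mF F0.
pose f1 (t : T) : cylType R I := fun i => X i t.
pose f2 (tx : T * measurableTypeR R) : cylType R I :=
  upd (fun i => X i tx.1) a tx.2.
have mf1 : measurable_fun setT f1 by exact: measurable_to_cyl.
have mf2 : measurable_fun setT f2 by exact: (measurable_resample a mX).
transitivity (\int[pushforward P f1]_w F w)%E.
  by rewrite (ge0_integral_pushforward mf1)//.
transitivity (\int[pushforward (P \x nu)%E f2]_w F w)%E; last first.
  rewrite (ge0_integral_pushforward mf2)//.
  rewrite preimage_setT.
  rewrite (fubini_tonelli1 (F \o f2))//=.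
  exact: (measurableT_comp mF mf2).
(* Packing both maps as measurable functions lets their pushforwards be recognised as measures, so
   that uniqueness of measures on a pi-system applies. *)
pose HP := isMeasurableFun.Build _ _ _ _ _ mf1.
pose g1 : {mfun _ >-> _} := HB.pack f1 HP.
pose HP2 := isMeasurableFun.Build _ _ _ _ _ mf2.
pose g2 : {mfun _ >-> _} := HB.pack f2 HP2.
apply: (@eq_measure_integral _ _ _ _ (pushforward (P \x nu)%E g2)
  (pushforward P g1)) => A mA _.
have cT : cylinders R I setT.
  by exists (fun=> setT) => //; apply/seteqP; split.
have cT' : \bigcup_(k in [set: nat]) ((fun=> setT) k : set (cylType R I)) = setT.
  by rewrite bigcup_const.
have cm : cylinders R I `<=` (@measurable _ (cylType R I)).
  by move=> B ?; exact: sub_sigma_algebra.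
refine (@g_sigma_algebra_measure_unique _ R (cylType R I) (cylinders R I) cm
  (fun=> setT) (fun=> cT) cT' (pushforward P g1) (pushforward (P \x nu)%E g2) _ _ _ A mA).
- exact: setI_closed_cylinders.
- move=> _ [B mB ->].
  change (P (f1 @^-1` [set w | forall i, B i (w i)]) =
    (P \x nu)%E (f2 @^-1` [set w | forall i, B i (w i)])).
  have -> : f1 @^-1` [set w | forall i, B i (w i)] =
      \bigcap_(i in [set: I]) (X i @^-1` B i).
    apply/seteqP; split => t /=; first by move=> Bt i _; exact: Bt.
    by move=> Bt i; exact: Bt.
  (* After resampling, a box becomes a rectangle: the constraint on [X a] is dropped and reappears
     on the fresh variable. *)
  have -> : f2 @^-1` [set w | forall i, B i (w i)] =
     (\bigcap_(i in [set: I]) (X i @^-1` (if i == a then setT else B i)))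
       `*` B a.
    apply/seteqP; split => -[t x] /=.
      move=> Bt; split; last by have := Bt a; rewrite /f2/upd/= eqxx.
      by move=> i _; have := Bt i; rewrite /f2 /upd/=; case: ifP.
    move=> [Bt Bx] i; rewrite /f2/upd/=; case: eqP => [->//|/eqP ia].
    by have := Bt i Logic.I; rewrite (negbTE ia).
  rewrite iX//.
  have mB' i : measurable (if i == a then setT else B i).
    by case: ifP => // _; exact: measurableT.
  rewrite product_measure1E//; last first.
  - exact: mB.
  - apply: fin_bigcap_measurable => // i _.
    by rewrite -[Y in measurable Y]setTI; exact: mX.
  rewrite [X in (_ = X * _)%E](iX (fun i => if i == a then setT else B i) mB')
    (bigD1 a)//= [in RHS](bigD1 a)//= eqxx preimage_setT.
  rewrite probability_setT mul1e lX// muleC; congr (_ * _)%E.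
  by apply: eq_bigr => i /negbTE ->.
- move=> _; change (P (f1 @^-1` setT) < +oo)%E; rewrite preimage_setT.
  by rewrite probability_setT ltry.
Qed.

(** * Exponential moments of the standard normal law *)

Local Open Scope ereal_scope.
(** The Radon-Nikodym derivative of [normal_prob] equals [normal_pdf] almost everywhere, because
    both have the same integral over every measurable set. *)
Lemma integral_normal (R : realType) (m s : R) (g : R -> \bar R) :
  measurable_fun setT g -> (forall x, 0 <= g x) ->
  \int[normal_prob m s]_x g x =
  \int[lebesgue_measure]_x (g x * (normal_pdf m s x)%:E).
Proof.
move=> mg g0.
have dom := normal_prob_dominates m s.
rewrite -(Radon_Nikodym_SigmaFinite.change_of_variables dom)//.
apply: ae_eq_integral => //.
- apply: emeasurable_funM => //.
  exact: (measurable_int _ (Radon_Nikodym_SigmaFinite.f_integrable dom)).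
- apply: emeasurable_funM => //.
  by apply/measurable_EFinP; exact: measurable_normal_pdf.
- apply: ae_eqe_mul2l.
  apply: integral_ae_eq => //.
  + exact: Radon_Nikodym_SigmaFinite.f_integrable.
  + by apply/measurable_EFinP; exact: measurable_normal_pdf.
  + move=> E _ mE; rewrite -Radon_Nikodym_SigmaFinite.f_integral//.
Qed.
Local Close Scope ereal_scope.

(** Completing the square: tilting by an exponential only moves the mean. *)
Lemma normal_exp_tilt (R : realType) (l x : R) :
  expR (l * x - l ^+ 2 / 2) * normal_pdf 0 1 x = normal_pdf l 1 x.
Proof.
rewrite !normal_pdfE ?oner_eq0// mulrCA /normal_fun -expRD; congr (_ * expR _).
by rewrite expr1n subr0; field.
Qed.

Lemma integral_normal_exp (R : realType) (l : R) :
  (\int[normal_prob 0 1]_x (expR (l * x - l ^+ 2 / 2))%:E = 1)%E.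
Proof.
rewrite integral_normal; last 2 first.
- apply/measurable_EFinP; apply: measurableT_comp => //.
  by apply: measurable_funB => //; exact: measurable_funM.
- by move=> x; rewrite lee_fin expR_ge0.
rewrite -(integral_normal_pdf l 1).
by apply: eq_integral => x _; rewrite -EFinM normal_exp_tilt.
Qed.

(** Since 1/(1-y) = 1 + y + y^2/(1-y) and 1/(1-y) <= 2, this is 1 + x <= e^x. It is used at y = 2s
    for the moment generating function of a squared normal variable. *)
Lemma invr_le_expR (R : realType) (y : R) : y <= 1 / 2 ->
  (1 - y)^-1 <= expR (y + 2 * y ^+ 2).
Proof.
move=> y2; have y1 : 0 < 1 - y by lra.
have -> : (1 - y)^-1 = 1 + y / (1 - y) by field; lra.
apply: le_trans (expR_ge1Dx _) _; rewrite ler_expR.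
have -> : y / (1 - y) = y + y ^+ 2 / (1 - y) by field; lra.
rewrite lerD2l mulrC ler_wpM2r ?sqr_ge0// invf_ple ?posrE//; lra.
Qed.

(** Multiplying the density by e^(s x^2) changes the variance to 1/(1-2s), so the integrand is a
    constant times another normal density. The term 4 s^2 is the price that brings this constant
    below 1. *)
Lemma integral_normal_exp_sqr (R : realType) (s : R) : `|s| <= 1 / 4 ->
  (\int[normal_prob 0 1]_x (expR (s * (x ^+ 2 - 1) - 4 * s ^+ 2))%:E <= 1)%E.
Proof.
move=> /ler_normlP[s1 s2].
rewrite integral_normal; last 2 first.
- apply/measurable_EFinP; apply: measurableT_comp => //.
  apply: measurable_funB => //; apply: measurable_funM => //.
  by apply: measurable_funB => //; exact: measurable_funX.
- by move=> x; rewrite lee_fin expR_ge0.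
have v0 : 0 < (1 - 2 * s)^-1 by rewrite invr_gt0; lra.
pose sg := Num.sqrt (1 - 2 * s)^-1.
have sg0 : 0 < sg by rewrite sqrtr_gt0.
have sg2 : sg ^+ 2 = (1 - 2 * s)^-1 by rewrite sqr_sqrtr// ltW.
(* K^2 = e^(-2s - 8s^2) / (1 - 2s), which [invr_le_expR] bounds by 1. *)
pose K := expR (- s - 4 * s ^+ 2) * sg.
have K1 : K <= 1.
  rewrite /K -opprD expRN mulrC ler_pdivrMr ?expR_gt0// mul1r.
  rewrite -(@ler_pXn2r _ 2)// ?nnegrE ?expR_ge0 ?(ltW sg0)// sg2.
  rewrite -expRM_natl.
  have s3 : 2 * s <= 1 / 2 by lra.
  by apply: le_trans (invr_le_expR s3) _; rewrite ler_expR; lra.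
rewrite [leLHS](_ : _ = \int[lebesgue_measure]_x
    (K%:E * (normal_pdf 0 sg x)%:E))%E; last first.
  apply: eq_integral => x _; rewrite -!EFinM; congr (_%:E).
  rewrite !normal_pdfE ?oner_eq0 ?gt_eqF// /normal_peak /normal_fun.
  rewrite expr1n mul1r -mulrnAr sqrtrM ?sqr_ge0// sqrtr_sqr gtr0_norm// invfM.
  have -> : expR (s * (x ^+ 2 - 1) - 4 * s ^+ 2) =
    expR (- s - 4 * s ^+ 2) * expR (s * x ^+ 2).
    by rewrite -expRD; congr expR; lra.
  have -> : expR (- (x - 0) ^+ 2 / (sg ^+ 2 *+ 2)) =
     expR (s * x ^+ 2) * expR (- (x - 0) ^+ 2 / (1 *+ 2)).
    rewrite -expRD; congr expR; rewrite sg2 subr0.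
    by field; lra.
  rewrite /K mulrACA -!mulrA; congr (_ * _).
  by field; rewrite !gt_eqF// sqrtr_gt0 mulrn_wgt0// pi_gt0.
rewrite ge0_integralZl//.
  by rewrite integral_normal_pdf mule1 lee_fin.
by apply/measurable_EFinP; exact: measurable_normal_pdf.
by move=> x _; rewrite lee_fin normal_pdf_ge0.
by rewrite lee_fin mulr_ge0 ?expR_ge0 ?ltW.
Qed.

(** * Exponential supermartingales along the coordinates *)

Lemma measurable_upd (R : realType) (I : finType) (w : I -> R) (a : I) :
  measurable_fun setT (fun x : R => upd w a x : cylType R I).
Proof.
by apply: measurable_to_cyl => i; rewrite /upd; case: (i == a).
Qed.

Lemma upd_same (R : Type) (I : eqType) (w : I -> R) a x : upd w a x a = x.
Proof. by rewrite /upd eqxx. Qed.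

Lemma upd_other (R : Type) (I : eqType) (w : I -> R) a b x :
  b != a -> upd w a x b = w b.
Proof. by rewrite /upd => /negbTE ->. Qed.

(* Integrate out the coordinates of [S] in order of decreasing rank: when [a]
   is integrated, all remaining factors are constant in the coordinate [a]. *)
Lemma integral_prod_le1 d (T : measurableType d) (R : realType)
    (P : probability T R) (I : finType) (X : I -> T -> R)
    (nu : probability (measurableTypeR R) R) (rho : I -> nat)
    (f : I -> cylType R I -> R) (S : {set I}) :
  (forall i, measurable_fun setT (X i)) ->
  mutually_independent P X ->
  (forall a (B : set R), measurable B -> P (X a @^-1` B) = nu B) ->
  (forall a, measurable_fun setT (f a)) -> (forall a w, 0 <= f a w) ->
  (forall a w, a \in S -> (\int[nu]_x (f a (upd w a x))%:E <= 1)%E) ->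
  (forall a b w x, a \in S -> b \in S -> a != b -> (rho b <= rho a)%N ->
     f b (upd w a x) = f b w) ->
  (\int[P]_t (\prod_(a in S) f a (fun i => X i t))%:E <= 1)%E.
Proof.
move=> mX iX lX mf f0.
have mP (A : {set I}) : measurable_fun setT
    (fun w : cylType R I => \prod_(a in A) f a w).
  have -> : (fun w : cylType R I => \prod_(a in A) f a w) =
      (fun w => \prod_(a <- enum A) f a w).
    by apply/funext => w; rewrite big_enum.
  by apply: measurable_prod => i _; exact: mf.
have P0 (A : {set I}) w : 0 <= \prod_(a in A) f a w by exact: prodr_ge0.
move: {2}#|S| (erefl #|S|) => n; elim: n S => [|n IH] S cS f1 fP.
  move/eqP: cS; rewrite cards_eq0 => /eqP ->.
  under eq_integral do rewrite big_set0.
  by rewrite integral_cst//= mul1e probability_le1.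
have [a0 a0S] : exists a0, a0 \in S by apply/card_gt0P; rewrite cS.
(* A coordinate of maximal rank is integrated first; no other factor indexed by [S] reads it. *)
case: (@arg_maxnP _ a0 (mem S) rho a0S) => a aS amax.
have aS' : a \in S by [].
have mX' : measurable_fun setT ((fun t i => X i t) : T -> cylType R I).
  exact: measurable_to_cyl.
rewrite (@integral_resample _ _ _ P I X nu a
  (fun w => (\prod_(a in S) f a w)%:E) mX iX (lX a))//; last 2 first.
- exact/measurable_EFinP.
- by move=> w; rewrite lee_fin.
apply: le_trans (IH (S :\ a) _ _ _); last 3 first.
- by move: cS; rewrite (cardsD1 a) aS' => -[].
- by move=> b w; rewrite !inE => /andP[_ bS]; exact: f1.
- by move=> b c w x; rewrite !inE => /andP[_ bS] /andP[_ cS']; exact: fP.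
apply: ge0_le_integral => //.
- by move=> t _; apply: integral_ge0 => x _; rewrite lee_fin.
- apply: (@measurable_fun_fubini_tonelli_F _ _ T (measurableTypeR R) R nu
    (fun tx => (\prod_(b in S) f b (upd (fun i => X i tx.1) a tx.2))%:E)).
    apply/measurable_EFinP.
    exact: (measurableT_comp (mP S) (measurable_resample a mX)).
  by move=> x; rewrite lee_fin.
- apply/measurable_EFinP.
  exact: (measurableT_comp (mP (S :\ a)) mX').
- move=> t _.
  set w : cylType R I := fun i => X i t.
  rewrite [leLHS](_ : _ = \int[nu]_x
      ((\prod_(b in S :\ a) f b w)%:E * (f a (upd w a x))%:E))%E; last first.
    apply: eq_integral => x _; rewrite -EFinM; congr (_%:E).
    rewrite (big_setD1 a)//= mulrC; congr (_ * _).
    apply: eq_bigr => b; rewrite !inE => /andP[ba bS].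
    by apply: fP => //; [rewrite eq_sym|exact: amax].
  rewrite ge0_integralZl//.
  + by rewrite -[leRHS]mule1 lee_wpmul2l// ?lee_fin// f1.
  + apply/measurable_EFinP.
    exact: (measurableT_comp (mf a) (measurable_upd w a)).
  + by move=> x _; rewrite lee_fin.
  + by rewrite lee_fin.
Qed.

(** * Events of small probability and union bounds *)

(** The complementary form of [holds_with_prob]. Passing through a measurable superset allows events
    that quantify over uncountably many vectors. *)
Definition unlikely d (T : measurableType d) (R : realType)
    (P : probability T R) (E : set T) (q : R) : Prop :=
  exists A : set T, [/\ measurable A, E `<=` A & (P A <= q%:E)%E].

(** Chernoff's argument: the indicator of [h <= G] is at most e^(-h) e^G. *)
Lemma unlikely_exp_markov d (T : measurableType d) (R : realType)
    (P : probability T R) (G : T -> R) (h : R) :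
  measurable_fun setT G -> (\int[P]_t (expR (G t))%:E <= 1)%E ->
  unlikely P [set t | h <= G t] (expR (- h)).
Proof.
move=> mG G1; exists (G @^-1` `[h, +oo[); split.
- by rewrite -[X in measurable X]setTI; exact: mG.
- by move=> t /=; rewrite in_itv/= andbT.
have mA : measurable (G @^-1` `[h, +oo[).
  by rewrite -[X in measurable X]setTI; exact: mG.
rewrite -[X in P X]setIT -integral_indic//.
have mE : measurable_fun setT (fun t => (expR (G t))%:E).
  by apply/measurable_EFinP; exact: measurableT_comp.
apply: (@le_trans _ _ (\int[P]_t ((expR (- h))%:E * (expR (G t))%:E))%E).
  apply: ge0_le_integral => //.
  - by apply/measurable_EFinP; exact: measurable_indic.
  - by apply: emeasurable_funM => //; exact: measurable_cst.
  - move=> t _; rewrite -EFinM lee_fin -expRD indicE.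
    case: (boolP (t \in _)) => [|_]; last exact: expR_ge0.
    rewrite inE /= in_itv/= andbT => hG.
    by rewrite -expR0 ler_expR addrC subr_ge0.
rewrite ge0_integralZl//.
by rewrite -[leRHS]mule1 lee_wpmul2l// lee_fin expR_ge0.
Qed.

Lemma unlikelyS d (T : measurableType d) (R : realType)
    (P : probability T R) (E F : set T) (q r : R) :
  E `<=` F -> q <= r -> unlikely P F q -> unlikely P E r.
Proof.
move=> EF qr [A [mA FA PA]]; exists A; split => //.
  exact: subset_trans FA.
by apply: le_trans PA _; rewrite lee_fin.
Qed.

Lemma unlikelyU d (T : measurableType d) (R : realType)
    (P : probability T R) (E F : set T) (q r : R) :
  unlikely P E q -> unlikely P F r -> unlikely P (E `|` F) (q + r).
Proof.
move=> [A [mA EA PA]] [B [mB FB PB]]; exists (A `|` B); split.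
- exact: measurableU.
- exact: setUSS.
- by rewrite EFinD; apply: le_trans (leeD PA PB); exact: measureU2.
Qed.

Lemma unlikely_bigcup d (T : measurableType d) (R : realType)
    (P : probability T R) (J : finType) (E : J -> set T) (q : R) :
  (forall j, unlikely P (E j) q) ->
  unlikely P [set t | exists j, E j t] (#|J|%:R * q).
Proof.
move=> /choice[A] hA; exists (\big[setU/set0]_(j : J) A j); split.
- by apply: bigsetU_measurable => j _; case: (hA j).
- move=> t [j Ejt]; rewrite -bigcup_seq_cond; exists j => /=.
    by rewrite mem_index_enum.
  by have [_ + _] := hA j; apply.
- have : (P (\big[setU/set0]_(j : J) A j) <= \sum_(j : J) P (A j))%E.
    suff [] : measurable (\big[setU/set0]_(j : J) A j) /\
      (P (\big[setU/set0]_(j : J) A j) <= \sum_(j : J) P (A j))%E by [].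
    elim/big_rec2: _ => [|j x B _ [mB PB]]; first by rewrite measure0.
    have [mA _ _] := hA j; split; first exact: measurableU.
    apply: le_trans (_ : P (A j) + P B <= _)%E; first exact: measureU2.
    exact: leeD2l.
  move=> /le_trans; apply.
  apply: (@le_trans _ _ (\sum_(j : J) q%:E)%E).
    by apply: lee_sum => j _; case: (hA j).
  by rewrite sumEFin lee_fin sumr_const mulr_natl.
Qed.

(** * Tail bounds for Gaussian martingales *)

Definition iid_normal d (T : measurableType d) (R : realType)
    (P : probability T R) (I : finType) (X : I -> T -> R) : Prop :=
  mutually_independent P X /\ forall i, std_normal_rv P (X i).

(** The rank [rho] plays the part of time: among the coordinates in [S], an increment [g b] reads
    only its own and those of strictly smaller rank. Conditional exponential moments at most 1
    therefore multiply, and Markov's inequality finishes. *)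
Lemma unlikely_martingale d (T : measurableType d) (R : realType)
    (P : probability T R) (I : finType) (X : I -> T -> R) (rho : I -> nat)
    (g : I -> cylType R I -> R) (S : {set I}) (h : R) :
  iid_normal P X ->
  (forall a, measurable_fun setT (g a)) ->
  (forall a w, a \in S ->
     (\int[normal_prob 0 1]_x (expR (g a (upd w a x)))%:E <= 1)%E) ->
  (forall a b w x, a \in S -> b \in S -> a != b -> (rho b <= rho a)%N ->
     g b (upd w a x) = g b w) ->
  unlikely P [set t | h <= \sum_(a in S) g a (fun i => X i t)] (expR (- h)).
Proof.
move=> [iX nX] mg g1 gP.
have mX i : measurable_fun setT (X i) by have [] := nX i.
have mX' : measurable_fun setT ((fun t i => X i t) : T -> cylType R I).
  exact: measurable_to_cyl.
apply: unlikely_exp_markov.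
  rewrite (_ : (fun t => _) = (fun t => \sum_(a <- enum S) g a (fun i => X i t))).
    by apply: measurable_sum => a; exact: (measurableT_comp (mg a) mX').
  by apply/funext => t; rewrite big_enum.
rewrite (eq_integral (fun t =>
    (\prod_(a in S) expR (g a (fun i => X i t)))%:E)); last first.
  by move=> t _; rewrite expR_sum.
apply: (@integral_prod_le1 _ _ _ P I X (normal_prob 0 1) rho
  (fun a w => expR (g a w)) S) => //.
- by move=> a B mB; case: (nX a) => _; apply.
- by move=> a; exact: measurableT_comp.
- by move=> a b w x aS bS ab ba; rewrite gP.
Qed.

(** A Gaussian martingale with predictable coefficients [y] has sub-Gaussian tails governed by its
    quadratic variation. As that variation is random, its bound [V] is made part of the event. *)
Lemma unlikely_linear d (T : measurableType d) (R : realType)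
    (P : probability T R) (I : finType) (X : I -> T -> R) (rho : I -> nat)
    (y : I -> cylType R I -> R) (S : {set I}) (tau V : R) :
  iid_normal P X ->
  (forall a, measurable_fun setT (y a)) ->
  (forall a b w x, a \in S -> b \in S -> (rho b <= rho a)%N ->
     y b (upd w a x) = y b w) ->
  0 < tau -> 0 < V ->
  unlikely P [set t | tau <= \sum_(a in S) y a (fun i => X i t) * X a t /\
                 \sum_(a in S) y a (fun i => X i t) ^+ 2 <= V]
    (expR (- (tau ^+ 2 / (2 * V)))).
Proof.
move=> iX my yP tau0 V0.
(* This value maximises l tau - l^2 V / 2, with maximum tau^2 / (2 V). *)
pose l := tau / V.
have l0 : 0 < l by rewrite divr_gt0.
pose g a (w : cylType R I) := l * y a w * w a - (l * y a w) ^+ 2 / 2.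
apply: unlikelyS (lexx _) (@unlikely_martingale _ _ _ P I X rho g S _ iX _ _ _).
- move=> t /= [h1 h2]; rewrite /g sumrB.
  under eq_bigr do rewrite -mulrA.
  rewrite -mulr_sumr.
  under [X in _ <= _ - X]eq_bigr do rewrite exprMn mulrAC.
  rewrite -mulr_sumr.
  apply: (@le_trans _ _ (l * tau - l ^+ 2 / 2 * V)).
    by rewrite le_eqVlt; apply/orP; left; apply/eqP; rewrite /l; field; lra.
  apply: lerB; first by rewrite ler_wpM2l// ltW.
  by rewrite ler_wpM2l// divr_ge0// sqr_ge0.
- move=> a; apply: measurable_funB.
    apply: measurable_funM; last exact: measurable_coord.
    by apply: measurable_funM => //; exact: my.
  apply: measurable_funM => //; apply: measurable_funX.
  by apply: measurable_funM => //; exact: my.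
- move=> a w aS; rewrite /g.
  under eq_integral do rewrite yP// upd_same.
  by rewrite integral_normal_exp.
- move=> a b w x aS bS ab ba.
  by rewrite /g yP// upd_other// eq_sym.
Qed.

(** The sign of [s] selects the tail: positive for the upper one, negative for the lower one. Each
    factor reads a single coordinate, so a constant rank will do. *)
Lemma unlikely_chi2 d (T : measurableType d) (R : realType)
    (P : probability T R) (I : finType) (X : I -> T -> R)
    (S : {set I}) (s h : R) :
  iid_normal P X -> `|s| <= 1 / 4 ->
  unlikely P [set t | h + 4 * s ^+ 2 * #|S|%:R <=
                        s * \sum_(a in S) (X a t ^+ 2 - 1)] (expR (- h)).
Proof.
move=> iX s4.
pose g a (w : cylType R I) := s * (w a ^+ 2 - 1) - 4 * s ^+ 2.
apply: unlikelyS (lexx _)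
  (@unlikely_martingale _ _ _ P I X (fun=> 0%N) g S _ iX _ _ _).
- move=> t /= ht; rewrite /g sumrB -mulr_sumr sumr_const -[_ *+ #|S|]mulr_natr.
  by rewrite lerBrDr.
- move=> a; apply: measurable_funB => //; apply: measurable_funM => //.
  apply: measurable_funB => //; apply: measurable_funX.
  exact: measurable_coord.
- move=> a w aS; rewrite /g.
  under eq_integral do rewrite upd_same.
  exact: integral_normal_exp_sqr.
- by move=> a b w x aS bS ab ba; rewrite /g upd_other// eq_sym.
Qed.

(** * Bilinear forms on grids *)

(** Multiples of 1/N in [-1, 1], coded by a sign bit and a magnitude so that grid vectors form a
    finite type. *)
Definition gridval (R : realType) (N : nat) (g : bool * 'I_N.+1) : R :=
  (-1) ^+ g.1 * (g.2%:R / N%:R).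
Arguments gridval R {N} g.

(* Rounding towards 0 keeps the unit ball inside itself. *)
Lemma grid_round (R : realType) (N : nat) (x : R) : (0 < N)%N -> `|x| <= 1 ->
  exists g : bool * 'I_N.+1,
    `|x - gridval R g| <= N%:R^-1 /\ `|gridval R g| <= `|x|.
Proof.
move=> N0 x1.
have NR0 : (0 : R) < N%:R by rewrite ltr0n.
have y0 : 0 <= N%:R * `|x| by rewrite mulr_ge0// ltW.
pose n := Num.truncn (N%:R * `|x|).
have /andP[n1 n2] := truncn_itv y0; rewrite -/n in n1 n2.
have nN : (n < N.+1)%N.
  rewrite ltnS -(ler_nat R); apply: le_trans n1 _.
  by rewrite ger_pMr.
have n1' : n%:R / N%:R <= `|x| by rewrite ler_pdivrMr// mulrC.
have n2' : `|x| - n%:R / N%:R <= N%:R^-1.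
  rewrite -(ler_pM2l NR0) mulrBr mulrCA divff ?gt_eqF// mulr1.
  by rewrite lerBlDl -(natrD _ n 1) addn1 ltW.
have xE : x = (-1) ^+ (x < 0)%R * `|x| by rewrite -realEsign// num_real.
exists ((x < 0)%R, Ordinal nN); rewrite /gridval/=.
split.
  rewrite {1}xE -mulrBr normrM normrX normrN1 expr1n mul1r.
  by rewrite ger0_norm// subr_ge0.
by rewrite normrM normrX normrN1 expr1n mul1r ger0_norm// divr_ge0// ltW.
Qed.

Lemma sqr_norm_le1 (R : realType) (J : finType) (u : J -> R) :
  \sum_i u i ^+ 2 <= 1 -> forall i, `|u i| <= 1.
Proof.
move=> u1 i; rewrite -(@expr_le1 _ 2)// real_normK ?num_real//.
apply: le_trans u1; rewrite (bigD1 i)//= lerDl.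
by apply: sumr_ge0 => j _; exact: sqr_ge0.
Qed.

(** Rounding changes each product u_i v_j by at most 2/N, hence the whole form by at most 2 B |J1|
    |J2| / N <= 1. The entry bound [B] may be very crude, since [N] enters the union bound only
    through its logarithm. *)
Lemma bilinear_net (R : realType) (J1 J2 : finType) (M : J1 -> J2 -> R)
    (B tau : R) (N : nat) :
  (0 < N)%N -> (forall i j, `|M i j| <= B) ->
  2 * B * #|J1|%:R * #|J2|%:R <= N%:R ->
  (forall (g1 : {ffun J1 -> bool * 'I_N.+1}) (g2 : {ffun J2 -> bool * 'I_N.+1}),
     \sum_i gridval R (g1 i) ^+ 2 <= 1 -> \sum_j gridval R (g2 j) ^+ 2 <= 1 ->
     \sum_i \sum_j M i j * gridval R (g1 i) * gridval R (g2 j) <= tau) ->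
  forall u v, \sum_i u i ^+ 2 <= 1 -> \sum_j v j ^+ 2 <= 1 ->
    \sum_i \sum_j M i j * u i * v j <= tau + 1.
Proof.
move=> N0 MB BN netM u v u1 v1.
have NR0 : (0 : R) < N%:R by rewrite ltr0n.
have [g1 g1P] := fin_all_exists (fun i => grid_round N0 (sqr_norm_le1 u1 i)).
have [g2 g2P] := fin_all_exists (fun j => grid_round N0 (sqr_norm_le1 v1 j)).
have grid_le (J : finType) (w : J -> R) (g : J -> bool * 'I_N.+1) :
    \sum_i w i ^+ 2 <= 1 ->
    (forall i, `|w i - gridval R (g i)| <= N%:R^-1 /\
       `|gridval R (g i)| <= `|w i|) ->
    \sum_i gridval R (finfun g i) ^+ 2 <= 1.
  move=> w1 gP; apply: le_trans w1; apply: ler_sum => i _.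
  rewrite ffunE -[leLHS]real_normK ?num_real// -[leRHS]real_normK ?num_real//.
  by rewrite lerXn2r ?nnegrE//; case: (gP i).
have := netM (finfun g1) (finfun g2) (grid_le _ _ _ u1 g1P) (grid_le _ _ _ v1 g2P).
move=> le_tau.
rewrite -[leLHS](subrK (\sum_i \sum_j M i j * gridval R (finfun g1 i) *
  gridval R (finfun g2 j))) addrC; apply: lerD => //.
rewrite -sumrB.
apply: (@le_trans _ _ (\sum_(i : J1) \sum_(j : J2) (2 * B / N%:R))); last first.
  rewrite !sumr_const -[_ *+ #|J1|]mulr_natr -[_ *+ #|J2|]mulr_natr.
  rewrite (_ : _ * _ = 2 * B * #|J1|%:R * #|J2|%:R / N%:R); last by ring.
  by rewrite ler_pdivrMr// mul1r.
apply: ler_sum => i _; rewrite -sumrB; apply: ler_sum => j _.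
rewrite !ffunE; apply: le_trans (ler_norm _) _.
have B0 : 0 <= B by apply: le_trans (MB i j).
have -> : M i j * u i * v j - M i j * gridval R (g1 i) * gridval R (g2 j) =
   M i j * ((u i - gridval R (g1 i)) * v j +
    gridval R (g1 i) * (v j - gridval R (g2 j))) by ring.
rewrite normrM (_ : 2 * B / N%:R = B * (2 / N%:R)); last by ring.
apply: ler_pM => //.
apply: le_trans (ler_normD _ _) _.
rewrite (normrM (u i - _)) (normrM (gridval R _)) mulrDl mul1r.
have [a1 a2] := g1P i; have [b1 b2] := g2P j.
apply: lerD.
  by rewrite -[leRHS]mulr1 ler_pM// sqr_norm_le1.
rewrite -[leRHS]mul1r ler_pM//; apply: le_trans a2 _; exact: sqr_norm_le1.
Qed.

(** Nonzero vectors are normalised, and the sign of [u] is flipped for the lower bound; a zero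
    vector makes the form vanish. *)
Lemma bilinear_homogeneous (R : realType) (J1 J2 : finType)
    (M : J1 -> J2 -> R) (K : R) :
  (forall u v, \sum_i u i ^+ 2 <= 1 -> \sum_j v j ^+ 2 <= 1 ->
    \sum_i \sum_j M i j * u i * v j <= K) ->
  forall u v, (\sum_i \sum_j M i j * u i * v j) ^+ 2 <=
    K ^+ 2 * (\sum_i u i ^+ 2) * (\sum_j v j ^+ 2).
Proof.
move=> MK u v.
have sum0 (J : finType) (w : J -> R) : 0 <= \sum_i w i ^+ 2.
  by apply: sumr_ge0 => i _; exact: sqr_ge0.
have sum_eq0 (J : finType) (w : J -> R) : \sum_i w i ^+ 2 = 0 -> forall i, w i = 0.
  move=> /eqP; rewrite psumr_eq0 => [/allP w0 i|i _]; last exact: sqr_ge0.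
  by have /eqP := w0 i (mem_index_enum i); move/eqP; rewrite sqrf_eq0 => /eqP.
have [/eqP u0|u0] := boolP (\sum_i u i ^+ 2 == 0).
  rewrite big1; first by rewrite expr0n/= u0 mulr0 mul0r.
  by move=> i _; rewrite big1// => j _; rewrite (sum_eq0 _ _ u0) mulr0 mul0r.
have [/eqP v0|v0] := boolP (\sum_i v i ^+ 2 == 0).
  rewrite big1; first by rewrite expr0n/= v0 mulr0.
  by move=> i _; rewrite big1// => j _; rewrite (sum_eq0 _ _ v0) mulr0.
set a := \sum_i u i ^+ 2 in u0 *; set b := \sum_j v j ^+ 2 in v0 *.
have a0 : 0 < Num.sqrt a by rewrite sqrtr_gt0 lt_neqAle eq_sym u0 sum0.
have b0 : 0 < Num.sqrt b by rewrite sqrtr_gt0 lt_neqAle eq_sym v0 sum0.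
have unit (J : finType) (w : J -> R) (s : R) : s ^+ 2 = 1 ->
    0 < Num.sqrt (\sum_i w i ^+ 2) ->
    \sum_i (s * (w i / Num.sqrt (\sum_i w i ^+ 2))) ^+ 2 <= 1.
  move=> s1 w0; under eq_bigr do rewrite !exprMn s1 mul1r exprVn sqr_sqrtr//.
  by rewrite -mulr_suml divff// gt_eqF// -sqrtr_gt0.
have sgn s : s ^+ 2 = 1 ->
    s * (\sum_i \sum_j M i j * u i * v j) <= K * (Num.sqrt a * Num.sqrt b).
  move=> s1; rewrite -ler_pdivrMr ?mulr_gt0//.
  apply: le_trans (MK _ _ (unit _ u s s1 a0) (unit _ v 1 (expr1n _ _) b0)).
  rewrite le_eqVlt; apply/orP; left; apply/eqP.
  rewrite mulr_sumr mulr_suml; apply: eq_bigr => i _.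
  rewrite mulr_sumr mulr_suml; apply: eq_bigr => j _.
  by rewrite -/a -/b; field; rewrite !gt_eqF.
rewrite -[_ ^+ 2]real_normK ?num_real//.
have -> : K ^+ 2 * a * b = (K * (Num.sqrt a * Num.sqrt b)) ^+ 2.
  by rewrite [RHS]exprMn exprMn (sqr_sqrtr (sum0 _ u)) (sqr_sqrtr (sum0 _ v)) mulrA.
have Sle : `|\sum_i \sum_j M i j * u i * v j| <= K * (Num.sqrt a * Num.sqrt b).
  have h1 := sgn 1 (expr1n _ _); have h2 := sgn (-1) (sqrr_sign R 1%N).
  by rewrite ler_norml -lerNl; apply/andP; split; lra.
by rewrite lerXn2r ?nnegrE// (le_trans _ Sle).
Qed.

Lemma card_grid (J : finType) (N : nat) :
  #|{ffun J -> bool * 'I_N.+1}| = ((2 * N.+1) ^ #|J|)%N.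
Proof. by rewrite card_ffun card_prod card_bool card_ord. Qed.

(** Union bound over all pairs of grid vectors. The good event [G] supplies the entry bound needed
    for rounding, and it may also be used in each single tail estimate. *)
Lemma unlikely_bilinear d (T : measurableType d) (R : realType)
    (P : probability T R) (J1 J2 : finType) (M : J1 -> J2 -> T -> R)
    (G : set T) (B tau q : R) (N : nat) :
  (0 < N)%N -> 0 <= q -> 2 * B * #|J1|%:R * #|J2|%:R <= N%:R ->
  (forall t, G t -> forall i j, `|M i j t| <= B) ->
  (forall u v, \sum_i u i ^+ 2 <= 1 -> \sum_j v j ^+ 2 <= 1 ->
    unlikely P [set t | G t /\ tau <= \sum_i \sum_j M i j t * u i * v j] q) ->
  unlikely P [set t | G t /\ ~ forall u v,
      (\sum_i \sum_j M i j t * u i * v j) ^+ 2 <=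
      (tau + 1) ^+ 2 * (\sum_i u i ^+ 2) * (\sum_j v j ^+ 2)]
    (((2 * N.+1) ^ (#|J1| + #|J2|))%:R * q).
Proof.
move=> N0 q0 BN GB uM.
pose E (g : {ffun J1 -> bool * 'I_N.+1} * {ffun J2 -> bool * 'I_N.+1}) : set T :=
  [set t | [/\ G t, \sum_i gridval R (g.1 i) ^+ 2 <= 1,
    \sum_j gridval R (g.2 j) ^+ 2 <= 1 &
    tau <= \sum_i \sum_j M i j t * gridval R (g.1 i) * gridval R (g.2 j)]].
(* Grid vectors outside the unit ball give an empty event, so the union can run over the full finite
   type. *)
have uE g : unlikely P (E g) q.
  have [g1|g1] := boolP (\sum_i gridval R (g.1 i) ^+ 2 <= 1); last first.
    exists set0; split => //; last by rewrite measure0 lee_fin.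
    by move=> t [_ g1']; move: g1; rewrite g1'.
  have [g2|g2] := boolP (\sum_j gridval R (g.2 j) ^+ 2 <= 1); last first.
    exists set0; split => //; last by rewrite measure0 lee_fin.
    by move=> t [_ _ g2']; move: g2; rewrite g2'.
  by apply: unlikelyS (lexx _) (uM _ _ g1 g2) => t [].
apply: unlikelyS (_ : _ <= _) (unlikely_bigcup uE); last first.
  by rewrite card_prod !card_grid expnD.
move=> t [Gt]; apply: contra_notP => noE.
apply: bilinear_homogeneous; apply: (@bilinear_net _ _ _ _ B tau N) => //.
  exact: GB.
move=> g1 g2 g1P g2P; rewrite leNgt; apply/negP => lt; apply: noE.
by exists (g1, g2); split => //; exact: ltW.
Qed.

(** * Gaussian rows *)

Definition rect (I J : finType) (A : pred I) (Q : pred J) : {set I * J} :=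
  [set a : I * J | A a.1 && Q a.2]%SET.

Lemma in_rect (I J : finType) (A : pred I) (Q : pred J) (a : I * J) :
  (a \in rect A Q) = A a.1 && Q a.2.
Proof. by rewrite inE. Qed.

Lemma sum_rect (R : realType) (I J : finType) (A : pred I) (Q : pred J)
    (F : I * J -> R) :
  \sum_(a in rect A Q) F a =
  \sum_(i | A i) \sum_(j | Q j) F (i, j).
Proof.
rewrite (pair_big A Q (fun i j => F (i, j)))/=.
by apply: eq_big => [[i j]|[i j] _]; rewrite ?in_rect.
Qed.

(** With [Q] one half of the columns and [predC Q] the other, these are the products <a_i, a_l> and
    <b_i, b_l>. *)
Definition ip (R : realType) (k p : nat) (Q : pred 'I_p)
    (w : 'I_k * 'I_p -> R) (i l : 'I_k) : R :=
  \sum_(j | Q j) w (i, j) * w (l, j).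

Lemma measurable_bigsum d (T : measurableType d) (R : realType) (J : finType)
    (Q : pred J) (f : J -> T -> R) :
  (forall j, measurable_fun setT (f j)) ->
  measurable_fun setT (fun t => \sum_(j | Q j) f j t).
Proof.
move=> mf; rewrite (_ : (fun t => _) = (fun t => \sum_(j <- enum Q) f j t)).
  exact: measurable_sum.
by apply/funext => t; rewrite big_enum.
Qed.

Section gaussian_rows.
Context d (T : measurableType d) (R : realType) (P : probability T R).
Variables (k p : nat) (X : 'I_k * 'I_p -> T -> R).
Hypothesis iX : iid_normal P X.
Implicit Types (Q : pred 'I_p) (i l : 'I_k).

(** Both tails of a chi-square variable, from the parameters [c] and [- c]. *)
Lemma unlikely_row_norm Q i (c h : R) : 0 < c -> c <= 1 / 4 ->
  unlikely P [set t | h + 4 * c ^+ 2 * #|Q|%:R <=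
      c * `|ip Q (fun a => X a t) i i - #|Q|%:R|] (2 * expR (- h)).
Proof.
move=> c0 c4.
pose S := rect (pred1 i) Q.
have cS : #|S| = #|Q|.
  rewrite -(card_imset (mem Q) (_ : injective (fun j => (i, j)))); last first.
    by move=> j j' [].
  apply: eq_card => -[l j]; rewrite in_rect/=; apply/andP/imsetP.
    by move=> [/eqP -> Qj]; exists j.
  by move=> [j' Qj' [-> ->]]; rewrite eqxx.
have Ssum t : \sum_(a in S) (X a t ^+ 2 - 1) =
    ip Q (fun a => X a t) i i - #|Q|%:R.
  rewrite sum_rect (big_pred1 i)// sumrB; congr (_ - _).
  by rewrite sumr_const.
have s1 : `|c| <= 1 / 4 by rewrite gtr0_norm.
have s2 : `|- c| <= 1 / 4 by rewrite normrN.
have := unlikelyU (@unlikely_chi2 _ _ _ P _ X S c h iX s1)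
  (@unlikely_chi2 _ _ _ P _ X S (- c) h iX s2).
apply: unlikelyS; last by rewrite [leRHS]mulr_natl.
move=> t /=; rewrite cS Ssum sqrrN.
case: (lerP 0 (ip Q (fun a => X a t) i i - #|Q|%:R)) => [s0|s0].
  by rewrite ger0_norm//; left.
by rewrite ltr0_norm// mulrN mulNr; right.
Qed.

(** Given row [l], the inner product is linear in the independent row [i], with variance the squared
    norm of row [l] on [Q]. *)
Lemma unlikely_row_inner Q i l (tau V : R) : i != l -> 0 < tau -> 0 < V ->
  unlikely P [set t | tau <= `|ip Q (fun a => X a t) i l| /\
      ip Q (fun a => X a t) l l <= V] (2 * expR (- (tau ^+ 2 / (2 * V)))).
Proof.
move=> il tau0 V0.
pose S := rect (pred1 i) Q.
have one_side (s : R) : s ^+ 2 = 1 ->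
    unlikely P [set t | tau <= s * ip Q (fun a => X a t) i l /\
      ip Q (fun a => X a t) l l <= V] (expR (- (tau ^+ 2 / (2 * V)))).
  move=> s1; pose y (a : 'I_k * 'I_p) (w : cylType R ('I_k * 'I_p)%type) : R :=
    s * (w : 'I_k * 'I_p -> R) (l, a.2).
  apply: unlikelyS (lexx _) (@unlikely_linear _ _ _ P _ X (fun=> 0%N) y S
    tau V iX _ _ tau0 V0).
  - move=> t /= []; rewrite /y !sum_rect !(big_pred1 i)//= => h1 h2; split.
      apply: le_trans h1 _; rewrite le_eqVlt; apply/orP; left; apply/eqP.
      by rewrite mulr_sumr; apply: eq_bigr => j _; rewrite mulrA mulrAC.
    apply: le_trans h2; rewrite le_eqVlt; apply/orP; left; apply/eqP.
    by apply: eq_bigr => j _; rewrite exprMn s1 mul1r expr2.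
  - move=> a; apply: measurable_funM => //; exact: measurable_coord.
  - move=> a b w x; rewrite !in_rect => /andP[/eqP a1 _] _ _.
    by rewrite /y upd_other//; apply: contra il => /eqP E; rewrite -a1 -E eqxx.
have := unlikelyU (one_side 1 (expr1n _ _)) (one_side (-1) (sqrr_sign R 1%N)).
apply: unlikelyS; last by rewrite [leRHS]mulr_natl.
move=> t /= [h1 h2].
case: (lerP 0 (ip Q (fun a => X a t) i l)) => s0.
  by left; split => //; rewrite mul1r; move: h1; rewrite ger0_norm.
by right; split => //; rewrite mulN1r; move: h1; rewrite ltr0_norm.
Qed.

(** A linear form with deterministic coefficients u_i v_j, whose squares sum to |u|^2 |v|^2 <= 1. *)
Lemma unlikely_form (u : 'I_k -> R) (v : 'I_p -> R) (tau : R) :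
  \sum_i u i ^+ 2 <= 1 -> \sum_j v j ^+ 2 <= 1 -> 0 < tau ->
  unlikely P [set t | tau <= \sum_i \sum_j X (i, j) t * u i * v j]
    (expR (- (tau ^+ 2 / 2))).
Proof.
move=> u1 v1 tau0.
pose y (a : 'I_k * 'I_p) (w : cylType R ('I_k * 'I_p)%type) : R :=
  u a.1 * v a.2.
pose S := rect (@predT 'I_k) (@predT 'I_p).
have := @unlikely_linear _ _ _ P _ X (fun=> 0%N) y S tau 1 iX.
rewrite mulr1; move=> H; apply: unlikelyS (lexx _) (H _ _ tau0 ltr01) => //; last first.
  by move=> a; exact: measurable_cst.
move=> t /= ht; rewrite /y !sum_rect/=; split.
  apply: le_trans ht _; rewrite le_eqVlt; apply/orP; left; apply/eqP.
  by apply: eq_bigr => i _; apply: eq_bigr => j _; ring.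
apply: (@le_trans _ _ ((\sum_i u i ^+ 2) * (\sum_j v j ^+ 2))); last first.
  rewrite -[leRHS]mulr1; apply: ler_pM => //;
    by apply: sumr_ge0 => ? _; exact: sqr_ge0.
rewrite mulr_suml le_eqVlt; apply/orP; left; apply/eqP.
apply: eq_bigr => i _; rewrite mulr_sumr; apply: eq_bigr => j _.
by rewrite exprMn.
Qed.

(* The form is a martingale in the rows: given the coordinates in [Q] and the
   rows before [j], the terms containing row [j] are linear in its coordinates
   in [Q']. *)
Lemma unlikely_triangular_form Q Q' (u v : 'I_k -> R) (tau V : R) :
  (forall j, Q' j -> ~~ Q j) -> 0 < tau -> 0 < V ->
  unlikely P [set t | tau <= \sum_(i < k) \sum_(j < k)
        (if (i < j)%N then ip Q (fun a => X a t) i j * ip Q' (fun a => X a t) i j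
         else 0) * u i * v j /\
      \sum_(j < k) \sum_(s | Q' s) (v j * \sum_(i < k | (i < j)%N)
         u i * ip Q (fun a => X a t) i j * X (i, s) t) ^+ 2 <= V]
    (expR (- (tau ^+ 2 / (2 * V)))).
Proof.
move=> QQ' tau0 V0.
pose y (a : 'I_k * 'I_p) (w : cylType R ('I_k * 'I_p)%type) : R :=
  v a.1 * \sum_(i < k | (i < a.1)%N)
    u i * ip Q w i a.1 * (w : 'I_k * 'I_p -> R) (i, a.2).
pose S := rect (@predT 'I_k) Q'.
apply: unlikelyS (lexx _) (@unlikely_linear _ _ _ P _ X
  (fun a => val a.1) y S tau V iX _ _ tau0 V0).
- move=> t /= []; rewrite /y !sum_rect/= => h1 h2; split => //.
  apply: le_trans h1 _; rewrite le_eqVlt; apply/orP; left; apply/eqP.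
  rewrite exchange_big/=; apply: eq_bigr => j _.
  under [RHS]eq_bigr do rewrite -mulrA mulr_suml mulr_sumr.
  rewrite exchange_big/= [RHS]big_mkcond/=; apply: eq_bigr => i _.
  case: ifP => _; last by rewrite !mul0r.
  rewrite [X in _ * X * _ * _ = _]/ip mulr_sumr !mulr_suml; apply: eq_bigr => s _.
  by ring.
- move=> a; apply: measurable_funM => //.
  apply: measurable_bigsum => i; apply: measurable_funM; last first.
    exact: measurable_coord.
  apply: measurable_funM => //; apply: measurable_bigsum => j.
  by apply: measurable_funM; exact: measurable_coord.
- move=> a b w x; rewrite !in_rect => /= Qa _ ba; rewrite /y; congr (_ * _).
  apply: eq_bigr => i ib; rewrite upd_other; last first.
    by apply: contraTneq ib => E; move: ba; rewrite -E/= -leqNgt.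
  congr (_ * _ * _); apply: eq_bigr => j Qj.
  (* Only coordinates with column in [Q'] are integrated, so the products over [Q] stay frozen. *)
  have aj : j != a.2 by apply: contraTneq Qj => ->; exact: QQ'.
  by rewrite !upd_other//; apply: contra aj => /eqP E; rewrite -E.
Qed.

End gaussian_rows.

(** * Consequences of an operator norm bound *)

Section form_bounds.
Variables (R : realType) (k p : nat) (w : 'I_k * 'I_p -> R) (K : R).
Hypothesis wK : forall (u : 'I_k -> R) (v : 'I_p -> R),
  (\sum_i \sum_j w (i, j) * u i * v j) ^+ 2 <=
    K * (\sum_i u i ^+ 2) * (\sum_j v j ^+ 2).
Implicit Types Q : pred 'I_p.

Lemma sqr_le_mul_cancel (a b : R) : 0 <= a -> 0 <= b -> a ^+ 2 <= b * a -> a <= b.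
Proof.
rewrite le_eqVlt => /predU1P[<-//|a0] b0.
by rewrite expr2 ler_pM2r.
Qed.

(** Duality: testing the form at x, the restriction to [Q] of the combination of rows with weights
    [z], gives |x|^4 <= K |z|^2 |x|^2, and one factor |x|^2 cancels. *)
Lemma rows_bound Q (z : 'I_k -> R) : 0 <= K ->
  \sum_(s | Q s) (\sum_i z i * w (i, s)) ^+ 2 <= K * \sum_i z i ^+ 2.
Proof.
move=> K0.
pose x s := if Q s then \sum_i z i * w (i, s) else 0.
have xE : \sum_s x s ^+ 2 = \sum_(s | Q s) (\sum_i z i * w (i, s)) ^+ 2.
  rewrite [RHS]big_mkcond; apply: eq_bigr => s _; rewrite /x.
  by case: ifP => // _; rewrite expr0n.
rewrite -xE; apply: sqr_le_mul_cancel.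
- by apply: sumr_ge0 => s _; exact: sqr_ge0.
- by rewrite mulr_ge0// sumr_ge0// => i _; exact: sqr_ge0.
apply: le_trans (wK z x); rewrite le_eqVlt; apply/orP; left; apply/eqP.
congr (_ ^+ 2); rewrite exchange_big/=; apply: eq_bigr => s _.
rewrite -mulr_suml expr2; rewrite {1}/x /x; case: ifP => _; last by rewrite !mulr0.
by congr (_ * _); apply: eq_bigr => i _; rewrite mulrC.
Qed.

(** The transposed duality argument, with the form tested at the vector of row products against
    [x]. *)
Lemma cols_bound Q (x : 'I_p -> R) : 0 <= K ->
  \sum_i (\sum_(s | Q s) w (i, s) * x s) ^+ 2 <= K * \sum_(s | Q s) x s ^+ 2.
Proof.
move=> K0.
pose x' s := if Q s then x s else 0.
have xE : \sum_s x' s ^+ 2 = \sum_(s | Q s) x s ^+ 2.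
  rewrite [RHS]big_mkcond; apply: eq_bigr => s _; rewrite /x'.
  by case: ifP => // _; rewrite expr0n.
pose z i := \sum_(s | Q s) w (i, s) * x s.
apply: sqr_le_mul_cancel.
- by apply: sumr_ge0 => s _; exact: sqr_ge0.
- by rewrite mulr_ge0// sumr_ge0// => i _; exact: sqr_ge0.
rewrite mulrAC -xE; apply: le_trans (wK z x').
rewrite le_eqVlt; apply/orP; left; apply/eqP.
congr (_ ^+ 2); apply: eq_bigr => i _.
rewrite expr2 {1}/z big_mkcond/= mulr_suml; apply: eq_bigr => s _.
by rewrite /x'; case: ifP => _; rewrite ?mulr0 ?mul0r// mulrAC.
Qed.

End form_bounds.

(** * The linear system and the fitted matrix *)

Lemma ip_sym (R : realType) (k p : nat) (Q : pred 'I_p)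
    (w : 'I_k * 'I_p -> R) i l : ip Q w i l = ip Q w l i.
Proof. by apply: eq_bigr => j _; rewrite mulrC. Qed.

(** A kernel vector annihilates the form, so coercivity forces it to be zero and the matrix is
    invertible. *)
Lemma posdef_solve (R : realType) (k : nat) (G : 'I_k -> 'I_k -> R) (lam : R)
    (e : 'I_k -> R) : 0 < lam ->
  (forall u : 'I_k -> R,
     lam * \sum_i u i ^+ 2 <= \sum_i \sum_l G i l * u i * u l) ->
  exists c : 'I_k -> R, forall l, \sum_i G i l * c i = e l.
Proof.
move=> lam0 posG.
pose A := \matrix_(i, l) G i l.
have freeA : row_free A.
  apply: inj_row_free => v vA; apply/rowP => i; rewrite mxE.
  have := posG (v 0); rewrite exchange_big/= [leRHS]big1 => [H|l _]; last first.
    move/rowP : vA => /(_ l); rewrite !mxE => vA.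
    rewrite -mulr_suml (_ : \sum_i _ = 0) ?mul0r// -[RHS]vA.
    by apply: eq_bigr => j _; rewrite !mxE mulrC.
  have : \sum_j v 0 j ^+ 2 == 0.
    rewrite eq_le sumr_ge0 ?andbT => [|j _]; last exact: sqr_ge0.
    by move: H; rewrite pmulr_rle0.
  rewrite psumr_eq0 => [/allP v0|j _]; last exact: sqr_ge0.
  by have := v0 i (mem_index_enum i); rewrite sqrf_eq0 => /eqP.
rewrite row_free_unit in freeA.
pose c := (\row_l e l) *m invmx A.
exists (c 0) => l.
have : (c *m A) 0 l = e l by rewrite /c mulmxKV// mxE.
by rewrite mxE => <-; apply: eq_bigr => i _; rewrite !mxE mulrC.
Qed.

(** Testing the system against [c] bounds its Euclidean norm, hence its l1 norm by k e0 / lam.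
    Isolating the diagonal term of each equation then turns the l1 bound into a bound on every
    entry. *)
Lemma solution_bounds (R : realType) (k : nat) (G : 'I_k -> 'I_k -> R)
    (lam D E e0 : R) (e c : 'I_k -> R) :
  0 < lam -> 0 < D -> 0 <= E -> 0 < e0 ->
  (forall u : 'I_k -> R,
     lam * \sum_i u i ^+ 2 <= \sum_i \sum_l G i l * u i * u l) ->
  (forall i, D <= G i i) -> (forall i l, i != l -> `|G i l| <= E) ->
  (forall i, `|e i| <= e0) ->
  (forall l, \sum_i G i l * c i = e l) ->
  forall i, `|c i| <= (e0 + E * (k%:R * e0 / lam)) / D.
Proof.
move=> lam0 D0 E0 e00 posG GD GE ee0 Gc.
have c2 : \sum_i c i ^+ 2 <= k%:R * (e0 / lam) ^+ 2.
  have h1 : lam * \sum_i c i ^+ 2 <= \sum_i e i * c i.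
    apply: le_trans (posG c) _; rewrite exchange_big/=.
    apply: ler_sum => l _; rewrite -Gc mulr_suml.
    by apply: ler_sum => i _; lra.
  have h2 : \sum_i e i * c i <=
      \sum_i (lam / 2 * c i ^+ 2 + e0 ^+ 2 / (2 * lam)).
    apply: ler_sum => i _.
    have e2 : e i ^+ 2 <= e0 ^+ 2.
      by rewrite -[leLHS]real_normK ?num_real// lerXn2r ?nnegrE// ltW.
    have sq : 0 <= (lam * c i - e i) ^+ 2 / (2 * lam).
      by rewrite divr_ge0 ?sqr_ge0// mulr_ge0// ltW.
    (* Young's inequality with weight [lam]: half of the coercive term absorbs c_i^2. *)
    have -> : e i * c i = lam / 2 * c i ^+ 2 + e i ^+ 2 / (2 * lam) -
        (lam * c i - e i) ^+ 2 / (2 * lam) by field; rewrite gt_eqF.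
    have : e i ^+ 2 / (2 * lam) <= e0 ^+ 2 / (2 * lam).
      by rewrite ler_pM2r// invr_gt0 mulr_gt0.
    lra.
  move: h2; rewrite big_split/= -mulr_sumr sumr_const card_ord => h2.
  have h3 := le_trans h1 h2.
  have h4 : lam / 2 * \sum_i c i ^+ 2 <= k%:R * (e0 ^+ 2 / (2 * lam)).
    by rewrite mulr_natl; lra.
  rewrite -(@ler_pM2l _ (lam / 2)) ?divr_gt0//; apply: le_trans h4 _.
  by rewrite le_eqVlt; apply/orP; left; apply/eqP; field; rewrite gt_eqF.
have c1 : \sum_i `|c i| <= k%:R * e0 / lam.
  (* The bound on the mean square of the c_i is s^2; with this weight the AM-GM inequality gives the
     same bound as Cauchy-Schwarz. *)
  pose s := e0 / lam.
  have s0 : 0 < s by rewrite divr_gt0.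
  have h1 : \sum_i `|c i| <= \sum_i (c i ^+ 2 / (2 * s) + s / 2).
    apply: ler_sum => i _; rewrite -[c i ^+ 2]real_normK ?num_real//.
    have sq : 0 <= (`|c i| - s) ^+ 2 / (2 * s).
      by rewrite divr_ge0 ?sqr_ge0// mulr_ge0// ltW.
    rewrite -subr_ge0; apply: le_trans sq _.
    by rewrite le_eqVlt; apply/orP; left; apply/eqP; field; rewrite gt_eqF.
  apply: le_trans h1 _; rewrite big_split/= -mulr_suml sumr_const card_ord.
  have h2 : (\sum_i c i ^+ 2) / (2 * s) <= k%:R * s ^+ 2 / (2 * s).
    by rewrite ler_pM2r// invr_gt0 mulr_gt0.
  have -> : k%:R * e0 / lam = k%:R * s ^+ 2 / (2 * s) + s / 2 *+ k.
    rewrite -[s / 2 *+ k]mulr_natl /s; field.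
    by rewrite !gt_eqF.
  by rewrite lerD2r.
move=> i; rewrite ler_pdivlMr//.
have Gii : G i i * c i = e i - \sum_(l | l != i) G l i * c l.
  by rewrite -Gc (bigD1 i)//= addrK.
have Gi0 : 0 < G i i by apply: lt_le_trans D0 (GD i).
apply: (@le_trans _ _ (`|G i i * c i|)).
  by rewrite normrM (gtr0_norm Gi0) mulrC ler_wpM2r.
rewrite Gii; apply: le_trans (ler_normB _ _) _; apply: lerD => //.
apply: le_trans (ler_norm_sum _ _ _) _.
apply: (@le_trans _ _ (\sum_(l | l != i) E * `|c l|)).
  by apply: ler_sum => l li; rewrite normrM ler_wpM2r// GE.
rewrite -mulr_sumr ler_wpM2l//; apply: le_trans c1.
by rewrite [leRHS](bigD1 i)//= lerDr.
Qed.

Definition maskmx (R : realType) (k p : nat) (Q : pred 'I_p)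
    (w : 'I_k * 'I_p -> R) (i : 'I_k) : 'cV[R]_p :=
  \col_s (if Q s then w (i, s) else 0).

(* The quadratic form of this matrix is
   [x |-> \sum_i c i * <a_i, x> * <b_i, x>], where [a_i], [b_i] are the parts
   of row [i] supported in [Q] and in its complement. *)
Definition cross_mx (R : realType) (k p : nat) (Q : pred 'I_p)
    (w : 'I_k * 'I_p -> R) (c : 'I_k -> R) : 'M[R]_p :=
  \sum_i (c i / 2) *: (maskmx Q w i *m (maskmx (predC Q) w i)^T +
                       maskmx (predC Q) w i *m (maskmx Q w i)^T).

Lemma cross_mx_sym (R : realType) (k p : nat) (Q : pred 'I_p)
    (w : 'I_k * 'I_p -> R) (c : 'I_k -> R) :
  (cross_mx Q w c)^T = cross_mx Q w c.
Proof.
rewrite /cross_mx linear_sum/=; apply: eq_bigr => i _.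
by rewrite linearZ/= linearD/= !trmx_mul !trmxK addrC.
Qed.

Lemma maskmx_dot (R : realType) (k p : nat) (Q : pred 'I_p)
    (w : 'I_k * 'I_p -> R) (i : 'I_k) (x : 'cV[R]_p) :
  x^T *m maskmx Q w i = (\sum_(s | Q s) w (i, s) * x s 0)%:M.
Proof.
apply/matrixP => a b; rewrite !ord1 !mxE eqxx mulr1n [RHS]big_mkcond/=.
by apply: eq_bigr => s _; rewrite !mxE; case: ifP => _; rewrite ?mulr0// mulrC.
Qed.

Lemma maskmx_dotr (R : realType) (k p : nat) (Q : pred 'I_p)
    (w : 'I_k * 'I_p -> R) (i : 'I_k) (x : 'cV[R]_p) :
  (maskmx Q w i)^T *m x = (\sum_(s | Q s) w (i, s) * x s 0)%:M.
Proof. by rewrite -[LHS]trmxK trmx_mul trmxK maskmx_dot tr_scalar_mx. Qed.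

Lemma cross_mx_form (R : realType) (k p : nat) (Q : pred 'I_p)
    (w : 'I_k * 'I_p -> R) (c : 'I_k -> R) (x : 'cV[R]_p) :
  (x^T *m cross_mx Q w c *m x) 0 0 =
  \sum_i c i * ((\sum_(s | Q s) w (i, s) * x s 0) *
                (\sum_(s | ~~ Q s) w (i, s) * x s 0)).
Proof.
rewrite /cross_mx mulmx_sumr mulmx_suml summxE; apply: eq_bigr => i _.
rewrite -scalemxAr -scalemxAl mulmxDr mulmxDl !mulmxA.
rewrite -!(mulmxA _ _^T x) !maskmx_dotr !maskmx_dot -!scalar_mxM !mxE eqxx.
by rewrite !mulr1n; field.
Qed.

(** For [Y] = (I + [cross_mx])/p, the condition at row l is precisely equation l of the system.
    Positivity follows from AM-GM on each product, since the bounds from the two column blocks add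
    up to K |x|^2. *)
Lemma psd_fit (R : realType) (k p : nat) (Q : pred 'I_p)
    (w : 'I_k * 'I_p -> R) (q c : 'I_k -> R) (K m : R) :
  (0 < p)%N -> 0 <= K -> 0 <= m ->
  (forall (u : 'I_k -> R) (v : 'I_p -> R),
    (\sum_i \sum_j w (i, j) * u i * v j) ^+ 2 <=
      K * (\sum_i u i ^+ 2) * (\sum_j v j ^+ 2)) ->
  (forall l, \sum_i (ip Q w i l * ip (predC Q) w i l) * c i =
     p%:R * q l - (ip Q w l l + ip (predC Q) w l l)) ->
  (forall i, `|c i| <= m) -> K * m <= 1 ->
  exists Y : 'M[R]_p, psd Y /\
    forall i, let x := \col_s w (i, s) in (x^T *m Y *m x) 0 0 = q i.
Proof.
move=> p0 K0 m0 wK Gc cm Km.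
have pR0 : (0 : R) < p%:R by rewrite ltr0n.
have splitQ (f : 'I_p -> R) : \sum_s f s = \sum_(s | Q s) f s + \sum_(s | ~~ Q s) f s.
  exact: bigID.
have YE (x : 'cV[R]_p) : (x^T *m (p%:R^-1 *: (1%:M + cross_mx Q w c)) *m x) 0 0 =
    p%:R^-1 * (\sum_s x s 0 ^+ 2 + \sum_i c i *
      ((\sum_(s | Q s) w (i, s) * x s 0) * (\sum_(s | ~~ Q s) w (i, s) * x s 0))).
  rewrite -scalemxAr -scalemxAl mxE mulmxDr mulmxDl mulmx1 mxE cross_mx_form.
  congr (_ * (_ + _)); rewrite mxE.
  by apply: eq_bigr => s _; rewrite mxE expr2.
exists (p%:R^-1 *: (1%:M + cross_mx Q w c)); split; first split.
- by rewrite linearZ/= linearD/= trmx1 cross_mx_sym.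
- move=> x; rewrite YE mulr_ge0 ?invr_ge0 ?ler0n//.
  set S := (X in _ + X).
  suff : `|S| <= \sum_s x s 0 ^+ 2 by rewrite ler_norml addrC -lerBlDr sub0r => /andP[].
  pose a i := \sum_(s | Q s) w (i, s) * x s 0.
  pose b i := \sum_(s | ~~ Q s) w (i, s) * x s 0.
  apply: le_trans (ler_norm_sum _ _ _) _.
  apply: (@le_trans _ _ (\sum_i m / 2 * (a i ^+ 2 + b i ^+ 2))).
    apply: ler_sum => i _; rewrite normrM -/(a i) -/(b i).
    apply: (@le_trans _ _ (m * ((a i ^+ 2 + b i ^+ 2) / 2))); last first.
      by rewrite le_eqVlt; apply/orP; left; apply/eqP; ring.
    apply: ler_pM => //; rewrite ler_norml.
    have := sqr_ge0 (a i + b i); have := sqr_ge0 (a i - b i).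
    by move=> h1 h2; apply/andP; split; lra.
  rewrite -mulr_sumr big_split/=.
  have ha := cols_bound wK Q (fun s => x s 0) K0.
  have hb := cols_bound wK (predC Q) (fun s => x s 0) K0.
  rewrite splitQ.
  apply: (@le_trans _ _ (m / 2 * (K * \sum_(s | Q s) x s 0 ^+ 2 +
      K * \sum_(s | ~~ Q s) x s 0 ^+ 2))).
    by rewrite ler_wpM2l ?divr_ge0//; apply: lerD.
  rewrite -mulrDr -splitQ.
  have X0 : 0 <= \sum_s x s 0 ^+ 2 by apply: sumr_ge0 => s _; exact: sqr_ge0.
  have := ler_wpM2r X0 Km; have : 0 <= K * m by exact: mulr_ge0.
  by nra.
- move=> l x; rewrite YE.
  have -> : \sum_s x s 0 ^+ 2 = ip Q w l l + ip (predC Q) w l l.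
    by rewrite splitQ; congr (_ + _); apply: eq_bigr => s _; rewrite mxE expr2.
  have -> : \sum_i c i * ((\sum_(s | Q s) w (i, s) * x s 0) *
      (\sum_(s | ~~ Q s) w (i, s) * x s 0)) =
      p%:R * q l - (ip Q w l l + ip (predC Q) w l l).
    rewrite -Gc; apply: eq_bigr => i _; rewrite mulrC; congr (_ * _ * _);
      by apply: eq_bigr => s _; rewrite mxE.
  by field; rewrite gt_eqF.
Qed.

(** Isolates the strictly triangular part, the one with a martingale structure in the rows. *)
Lemma symmetric_form_split (R : realType) (k : nat) (G : 'I_k -> 'I_k -> R)
    (u : 'I_k -> R) : (forall i l, G i l = G l i) ->
  \sum_i \sum_l G i l * u i * u l = \sum_i G i i * u i ^+ 2 +
    2 * \sum_(i < k) \sum_(l < k) (if (i < l)%N then G i l else 0) * u i * u l.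
Proof.
move=> Gsym.
pose L (i l : 'I_k) := (if (i < l)%N then G i l else 0) * u i * u l.
have -> : \sum_i \sum_l G i l * u i * u l =
    \sum_i \sum_l (L i l + L l i + (if l == i then G i i * u i ^+ 2 else 0)).
  apply: eq_bigr => i _; apply: eq_bigr => l _; rewrite /L.
  case: (ltngtP i l) => [il|il|/val_inj ->].
  - have -> : l == i = false by apply/negbTE; rewrite -val_eqE/= gtn_eqF.
    by ring.
  - have -> : l == i = false by apply/negbTE; rewrite -val_eqE/= ltn_eqF.
    by rewrite Gsym; ring.
  - by rewrite eqxx; ring.
under eq_bigr do rewrite !big_split/=.
rewrite !big_split/= [X in _ + X + _]exchange_big/= -/L.
under [X in _ + _ + X]eq_bigr do rewrite -big_mkcond/= big_pred1_eq.
by rewrite /L; ring.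
Qed.

(** The deterministic core: [h] is the square root of p, [r] is a small power of p absorbing all
    losses, and [q i] is to be 1/pi_i^2. *)
Lemma fit_of_bounds (R : realType) (k p : nat) (Q : pred 'I_p)
    (w : 'I_k * 'I_p -> R) (q : 'I_k -> R) (r h : R) :
  4 <= r -> 400 * r ^+ 90 <= h -> p%:R = h ^+ 2 -> k%:R <= h ^+ 2 * r ^+ 40 ->
  `|#|Q|%:R - p%:R / 2 : R| <= 1 ->
  (forall i, `|ip Q w i i - #|Q|%:R| <= h * r ^+ 2) ->
  (forall i, `|ip (predC Q) w i i - #|predC Q|%:R| <= h * r ^+ 2) ->
  (forall i l, i != l -> `|ip Q w i l| <= h * r) ->
  (forall i l, i != l -> `|ip (predC Q) w i l| <= h * r) ->
  (forall (u : 'I_k -> R) (v : 'I_p -> R),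
    (\sum_i \sum_j w (i, j) * u i * v j) ^+ 2 <=
      (h * r ^+ 22 + 1) ^+ 2 * (\sum_i u i ^+ 2) * (\sum_j v j ^+ 2)) ->
  (forall u v : 'I_k -> R,
    (\sum_(i < k) \sum_(l < k) (if (i < l)%N then
        ip Q w i l * ip (predC Q) w i l else 0) * u i * v l) ^+ 2 <=
      (h ^+ 3 * r ^+ 46 + 1) ^+ 2 * (\sum_i u i ^+ 2) * (\sum_j v j ^+ 2)) ->
  (forall i, `|q i - 1| <= r ^+ 2 / h) ->
  exists Y : 'M[R]_p, psd Y /\
    forall i, let x := \col_s w (i, s) in (x^T *m Y *m x) 0 0 = q i.
Proof.
move=> r4 hbig ph kh cQ nQ nQ' aQ aQ' form tri q1.
have r1 : 1 <= r by lra.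
have rX (m n : nat) : (m <= n)%N -> r ^+ m <= r ^+ n by move=> mn; exact: ler_weXn2l.
have rge1 n : 1 <= r ^+ n by exact: exprn_ege1.
have h1 : 400 <= h by have := rge1 90; lra.
have h0 : 0 < h by lra.
have r0 : 0 < r by lra.
have r2h : 400 * r ^+ 2 <= h by have := rX 2 90 isT; lra.
have cQ' : #|predC Q|%:R = p%:R - #|Q|%:R :> R.
  have : (#|Q| + #|predC Q|)%:R = p%:R :> R by rewrite cardC card_ord.
  by rewrite natrD => <-; rewrite addrAC subrr add0r.
have p0 : (0 < p)%N by rewrite -(ltr0n R) ph exprn_gt0.
have hsq : 400 * (h * r ^+ 2) <= h ^+ 2.
  by rewrite mulrCA expr2 ler_pM2l.
have hr2 : 1 <= h * r ^+ 2.
  by rewrite -[leLHS]mulr1 ler_pM//; have := rge1 2; lra.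
have low Q0 (i : 'I_k) : `|#|Q0|%:R - p%:R / 2 : R| <= 1 ->
    `|ip Q0 w i i - #|Q0|%:R| <= h * r ^+ 2 -> h ^+ 2 / 4 <= ip Q0 w i i.
  by rewrite ph !ler_norml => /andP[a1 a2] /andP[b1 b2]; lra.
have cQ'2 : `|#|predC Q|%:R - p%:R / 2 : R| <= 1.
  rewrite cQ' -normrN (_ : - _ = #|Q|%:R - p%:R / 2)//; by field.
pose G i l := ip Q w i l * ip (predC Q) w i l.
have Gsym i l : G i l = G l i by rewrite /G ip_sym [ip (predC Q) _ _ _]ip_sym.
have GD i : h ^+ 4 / 16 <= G i i.
  have -> : h ^+ 4 / 16 = h ^+ 2 / 4 * (h ^+ 2 / 4) by field.
  have h20 : 0 <= h ^+ 2 / 4 by rewrite divr_ge0// exprn_ge0// ltW.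
  by apply: ler_pM => //; apply: low.
have GE i l : i != l -> `|G i l| <= h ^+ 2 * r ^+ 2.
  move=> il; have -> : h ^+ 2 * r ^+ 2 = (h * r) * (h * r) by ring.
  by rewrite normrM ler_pM//; [exact: aQ|exact: aQ'].
(* Half of the lower bound on the diagonal; the other half pays for twice the triangular part. *)
pose lam := h ^+ 4 / 32.
have lam0 : 0 < lam by rewrite divr_gt0// exprn_gt0.
have D0 : 0 < h ^+ 4 / 16 by rewrite divr_gt0// exprn_gt0.
have tri_small : 2 * (h ^+ 3 * r ^+ 46 + 1) <= h ^+ 4 / 32.
  have a : 1 <= h ^+ 3 * r ^+ 46.
    by rewrite -[leLHS]mulr1 ler_pM// exprn_ege1//; lra.
  have b : 400 * (h ^+ 3 * r ^+ 46) <= h ^+ 4.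
    rewrite mulrCA [in leRHS]exprSr ler_pM2l ?exprn_gt0//.
    by have := rX 46 90 isT; lra.
  lra.
have posG (u : 'I_k -> R) :
    lam * \sum_i u i ^+ 2 <= \sum_i \sum_l G i l * u i * u l.
  rewrite symmetric_form_split//.
  set U := \sum_i u i ^+ 2.
  have U0 : 0 <= U by apply: sumr_ge0 => i _; exact: sqr_ge0.
  have dg : h ^+ 4 / 16 * U <= \sum_i G i i * u i ^+ 2.
    by rewrite mulr_sumr; apply: ler_sum => i _; rewrite ler_wpM2r ?sqr_ge0.
  have := tri u u; rewrite -/U.
  set t := \sum_(i < k) _ => tU.
  have tU' : `|t| <= (h ^+ 3 * r ^+ 46 + 1) * U.
    have c0 : 0 <= (h ^+ 3 * r ^+ 46 + 1) * U.
      by rewrite mulr_ge0// addr_ge0// mulr_ge0// exprn_ge0// ltW.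
    rewrite -(@ler_pXn2r _ 2)// ?nnegrE// real_normK ?num_real//.
    by rewrite exprMn [U ^+ 2]expr2 mulrA.
  have := ler_wpM2r U0 tri_small.
  move: tU'; rewrite ler_norml => /andP[t1 t2] s1.
  rewrite /lam; nra.
have [c Gc] := posdef_solve (fun l => p%:R * q l -
   (ip Q w l l + ip (predC Q) w l l)) lam0 posG.
(* One share for the deviation of q from 1, and one for the norm fluctuation in each of the two
   column blocks. *)
pose e0 := 3 * (h * r ^+ 2).
have e00 : 0 < e0 by rewrite mulr_gt0//; lra.
have ee0 i : `|p%:R * q i - (ip Q w i i + ip (predC Q) w i i)| <= e0.
  have -> : p%:R * q i - (ip Q w i i + ip (predC Q) w i i) =
     p%:R * (q i - 1) - (ip Q w i i - #|Q|%:R)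
     - (ip (predC Q) w i i - #|predC Q|%:R) by rewrite cQ'; ring.
  have a : `|p%:R * (q i - 1)| <= h * r ^+ 2.
    have -> : h * r ^+ 2 = h ^+ 2 * (r ^+ 2 / h) by field; rewrite gt_eqF.
    by rewrite ph normrM [`|h ^+ 2|]ger0_norm ?exprn_ge0 ?(ltW h0)// ler_wpM2l// exprn_ge0// ltW.
  apply: le_trans (ler_normB _ _) _.
  have := ler_normB (p%:R * (q i - 1)) (ip Q w i i - #|Q|%:R).
  have := nQ i; have := nQ' i; rewrite /e0; lra.
have E0 : 0 <= h ^+ 2 * r ^+ 2 by rewrite mulr_ge0// exprn_ge0// ltW.
have cb := solution_bounds lam0 D0 E0 e00 posG GD GE ee0 Gc.
apply: (psd_fit p0 _ _ form Gc cb).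
- exact: sqr_ge0.
- rewrite divr_ge0 ?(ltW D0)// addr_ge0 ?(ltW e00)// mulr_ge0//.
  by rewrite divr_ge0 ?(ltW lam0)// mulr_ge0// ltW.
have k1 : k%:R * e0 / lam <= 96 * r ^+ 42 / h.
  apply: (@le_trans _ _ (h ^+ 2 * r ^+ 40 * e0 / lam)).
    by rewrite ler_pM2r ?invr_gt0// ler_pM2r.
  rewrite le_eqVlt; apply/orP; left; apply/eqP.
  rewrite /e0 /lam; by field; rewrite gt_eqF.
(* Here 99 = 3 + 96: the direct error plus the off-diagonal contribution. *)
have m1 : e0 + h ^+ 2 * r ^+ 2 * (k%:R * e0 / lam) <= 99 * (h * r ^+ 44).
  have a : h ^+ 2 * r ^+ 2 * (k%:R * e0 / lam) <= 96 * (h * r ^+ 44).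
    apply: le_trans (ler_wpM2l E0 k1) _.
    rewrite le_eqVlt; apply/orP; left; apply/eqP.
    by field; rewrite gt_eqF.
  have b : e0 <= 3 * (h * r ^+ 44) by rewrite /e0 ler_pM2l// ler_pM2l// rX.
  by apply: le_trans (lerD b a) _; lra.
have K1 : (h * r ^+ 22 + 1) ^+ 2 <= 4 * (h ^+ 2 * r ^+ 44).
  have a : 1 <= h * r ^+ 22 by rewrite -[leLHS]mulr1 ler_pM//; lra.
  have -> : 4 * (h ^+ 2 * r ^+ 44) = (2 * (h * r ^+ 22)) ^+ 2.
    by ring.
  have b : h * r ^+ 22 + 1 <= 2 * (h * r ^+ 22) by rewrite mulr2n mulrDl mul1r lerD2l.
  have c0 : 0 <= h * r ^+ 22 + 1 by rewrite addr_ge0// (le_trans _ a).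
  by rewrite lerXn2r ?nnegrE// (le_trans c0 b).
rewrite mulrA ler_pdivrMr// mul1r.
apply: le_trans (ler_pM _ _ K1 m1) _.
- exact: sqr_ge0.
- by rewrite addr_ge0 ?(ltW e00)// mulr_ge0// divr_ge0 ?(ltW lam0)// mulr_ge0// ltW.
have -> : 4 * (h ^+ 2 * r ^+ 44) * (99 * (h * r ^+ 44)) = h ^+ 3 * (396 * r ^+ 88).
  by ring.
have -> : h ^+ 4 / 16 = h ^+ 3 * (h / 16) by field.
rewrite ler_pM2l ?exprn_gt0//.
(* The remaining claim is 396 * 16 r^88 <= h; the factor 16 is absorbed by r^2, and 396 r^90 is
   below 400 r^90 <= h. *)
have r88 : 16 * r ^+ 88 <= r ^+ 90.
  have -> : r ^+ 90 = r ^+ 2 * r ^+ 88 by rewrite -exprD.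
  by rewrite ler_pM2r ?exprn_gt0// expr2; nra.
lra.
Qed.

(** * High-probability estimates *)

Lemma sum_sqr_bound (R : realType) (J : finType) (Q : pred J) (f : J -> R) j :
  Q j -> f j ^+ 2 <= \sum_(i | Q i) f i * f i.
Proof.
move=> Qj; rewrite (bigD1 j)//= -expr2 lerDl.
by apply: sumr_ge0 => i _; rewrite -expr2 sqr_ge0.
Qed.

(** For fixed j, the inner sums combine the rows with weights z_i = u_i <a_i, a_j>, so [rows_bound]
    gives at most K |z|^2 <= K A^2. The weights v_j^2 sum to at most 1. *)
Lemma triangular_variance (R : realType) (k p : nat) (Q Q' : pred 'I_p)
    (w : 'I_k * 'I_p -> R) (K A : R) (u v : 'I_k -> R) :
  0 <= K ->
  (forall (u : 'I_k -> R) (v : 'I_p -> R),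
    (\sum_i \sum_j w (i, j) * u i * v j) ^+ 2 <=
      K * (\sum_i u i ^+ 2) * (\sum_j v j ^+ 2)) ->
  (forall i l, i != l -> `|ip Q w i l| <= A) ->
  \sum_i u i ^+ 2 <= 1 -> \sum_j v j ^+ 2 <= 1 ->
  \sum_(j < k) \sum_(s | Q' s) (v j * \sum_(i < k | (i < j)%N)
     u i * ip Q w i j * w (i, s)) ^+ 2 <= K * A ^+ 2.
Proof.
move=> K0 wK QA u1 v1.
have KA0 : 0 <= K * A ^+ 2 by rewrite mulr_ge0// sqr_ge0.
apply: (@le_trans _ _ (\sum_j v j ^+ 2 * (K * A ^+ 2))); last first.
  by rewrite -mulr_suml ler_piMl.
apply: ler_sum => j _.
under eq_bigr do rewrite exprMn.
rewrite -mulr_sumr ler_wpM2l ?sqr_ge0//.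
pose z (i : 'I_k) := if (i < j)%N then u i * ip Q w i j else 0.
apply: (@le_trans _ _ (\sum_(s | Q' s) (\sum_i z i * w (i, s)) ^+ 2)).
  rewrite le_eqVlt; apply/orP; left; apply/eqP.
  apply: eq_bigr => s _; rewrite big_mkcond/=; congr (_ ^+ 2).
  by apply: eq_bigr => i _; rewrite /z; case: ifP => // _; rewrite mul0r.
apply: le_trans (rows_bound wK Q' z K0) _.
rewrite ler_wpM2l//.
apply: (@le_trans _ _ (\sum_i u i ^+ 2 * A ^+ 2)).
  apply: ler_sum => i _; rewrite /z; case: ifPn => ij; last first.
    by rewrite expr0n/= mulr_ge0// sqr_ge0.
  have ij' : i != j by apply: contraTneq ij => ->; rewrite ltnn.
  have A0 : 0 <= A by apply: le_trans (QA i j ij').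
  rewrite exprMn ler_wpM2l ?sqr_ge0// -[leLHS]real_normK ?num_real//.
  by rewrite lerXn2r ?nnegrE// QA.
by rewrite -mulr_suml ler_piMl ?sqr_ge0.
Qed.

(* [h] stands for [sqrt p]. *)
Definition typical (R : realType) (k p : nat) (Q : pred 'I_p) (r h : R)
    (w : 'I_k * 'I_p -> R) : Prop :=
  [/\ forall (b : bool) i, let Q' := if b then Q else predC Q in
        `|ip Q' w i i - #|Q'|%:R| <= h * r ^+ 2,
      forall (b : bool) i l, i != l ->
        `|ip (if b then Q else predC Q) w i l| <= h * r,
      forall (u : 'I_k -> R) (v : 'I_p -> R),
        (\sum_i \sum_j w (i, j) * u i * v j) ^+ 2 <=
          (h * r ^+ 22 + 1) ^+ 2 * (\sum_i u i ^+ 2) * (\sum_j v j ^+ 2) &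
      forall u v : 'I_k -> R,
        (\sum_(i < k) \sum_(l < k) (if (i < l)%N then
            ip Q w i l * ip (predC Q) w i l else 0) * u i * v l) ^+ 2 <=
          (h ^+ 3 * r ^+ 46 + 1) ^+ 2 * (\sum_i u i ^+ 2) * (\sum_j v j ^+ 2)].

(** Entropy against tail: each grid coordinate costs at most [r] in the exponent. *)
Lemma net_count_le (R : realType) (n c : nat) (r s : R) :
  n%:R <= expR r -> c%:R * r + r <= s ->
  (n ^ c)%:R * expR (- s) <= expR (- r).
Proof.
move=> nr cs.
apply: (@le_trans _ _ (expR (c%:R * r) * expR (- s))).
  rewrite ler_wpM2r ?expR_ge0// natrX expRM_natl.
  by rewrite lerXn2r ?nnegrE// expR_ge0.
by rewrite -expRD ler_expR; lra.
Qed.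

(** The estimates are layered, each on the event where earlier ones hold: row norms, then inner
    products and the operator norm, and finally the triangular form, whose variance needs the last
    two. *)
Lemma typical_whp d (T : measurableType d) (R : realType) (P : probability T R)
    (k p : nat) (X : 'I_k * 'I_p -> T -> R) (Q : pred 'I_p) (r h : R) :
  iid_normal P X ->
  4 <= r -> 400 * r ^+ 90 <= h -> p%:R = h ^+ 2 -> k%:R <= h ^+ 2 * r ^+ 40 ->
  (2 * (p ^ 4).+1)%:R <= expR r ->
  unlikely P [set t | ~ typical Q r h (fun a => X a t)]
    ((k * 2)%:R * (2 * expR (- r)) + (k * k * 2)%:R * (2 * expR (- r))
      + expR (- r) + expR (- r)).
Proof.
move=> iX r4 hbig ph kh grid.
have r1 : 1 <= r by lra.
have rX (m n : nat) : (m <= n)%N -> r ^+ m <= r ^+ n by move=> mn; exact: ler_weXn2l.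
have rge1 n : 1 <= r ^+ n by exact: exprn_ege1.
have r0 : 0 < r by lra.
have h400 : 400 <= h by have := rge1 90; lra.
have h0 : 0 < h by lra.
have hr2 : 400 * (h * r ^+ 2) <= h ^+ 2.
  by rewrite mulrCA expr2 ler_pM2l//; have := rX 2 90 isT; lra.
have hr0 : 0 <= h * r ^+ 2 by rewrite mulr_ge0// ?sqr_ge0// ltW.
have er0 : 0 <= expR (- r) by exact: expR_ge0.
pose QQ (b : bool) := if b then Q else predC Q.
pose w t : 'I_k * 'I_p -> R := fun a => X a t.
have p0 : (0 < p)%N by rewrite -(ltr0n R) ph exprn_gt0.
have cQ (Q0 : pred 'I_p) : #|Q0|%:R <= h ^+ 2 :> R.
  by rewrite -ph ler_nat -[leqRHS](card_ord p) max_card.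
pose norms t := forall b i, `|ip (QQ b) (w t) i i - #|QQ b|%:R| <= h * r ^+ 2.
pose inner t := forall b i l, i != l -> `|ip (QQ b) (w t) i l| <= h * r.
pose form t := forall (u : 'I_k -> R) (v : 'I_p -> R),
  (\sum_i \sum_j w t (i, j) * u i * v j) ^+ 2 <=
    (h * r ^+ 22 + 1) ^+ 2 * (\sum_i u i ^+ 2) * (\sum_j v j ^+ 2).
pose tri t := forall u v : 'I_k -> R,
  (\sum_(i < k) \sum_(l < k) (if (i < l)%N then
     ip Q (w t) i l * ip (predC Q) (w t) i l else 0) * u i * v l) ^+ 2 <=
    (h ^+ 3 * r ^+ 46 + 1) ^+ 2 * (\sum_i u i ^+ 2) * (\sum_j v j ^+ 2).
have norms_ip t b i : norms t -> ip (QQ b) (w t) i i <= 2 * h ^+ 2.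
  move=> /(_ b i); have := cQ (QQ b); rewrite ler_norml => c1 /andP[_]; lra.
(* With c = 1/h the correction 4 c^2 |Q| is at most 4, and r + 4 <= r^2. *)
have U1 : unlikely P [set t | ~ norms t] ((k * 2)%:R * (2 * expR (- r))).
  have H (bi : 'I_k * bool) := @unlikely_row_norm _ _ _ P k p X iX (QQ bi.2) bi.1
     h^-1 r.
  have h1 : 0 < h^-1 by rewrite invr_gt0.
  have h2 : h^-1 <= 1 / 4 by rewrite invf_ple ?posrE//; lra.
  have := unlikely_bigcup (fun bi => H bi h1 h2).
  rewrite card_prod card_ord card_bool.
  apply: unlikelyS => // t /= nt.
  apply: contra_notP nt => noE b i.
  rewrite leNgt; apply/negP => lt; apply: noE; exists (i, b) => /=.
  have e1 : h^-1 ^+ 2 * #|QQ b|%:R <= 1.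
    by rewrite exprVn mulrC ler_pdivrMr ?exprn_gt0// mul1r.
  have e2 : r ^+ 2 <= h^-1 * `|ip (QQ b) (fun a => X a t) i i - #|QQ b|%:R|.
    by rewrite mulrC ler_pdivlMr// mulrC ltW.
  have e3 : 4 * r <= r ^+ 2 by rewrite expr2; nra.
  lra.
(* Rows of squared norm at most 2 h^2 give the exponent r^2 / 4 >= r. *)
have U2 : unlikely P [set t | norms t /\ ~ inner t]
    ((k * k * 2)%:R * (2 * expR (- r))).
  pose E (c : 'I_k * 'I_k * bool) : set T := [set t | c.1.1 != c.1.2 /\
    (h * r <= `|ip (QQ c.2) (w t) c.1.1 c.1.2| /\
     ip (QQ c.2) (w t) c.1.2 c.1.2 <= 2 * h ^+ 2)].
  have UE c : unlikely P (E c) (2 * expR (- r)).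
    case: c => -[i l] b; have [->|il] := eqVneq i l.
      exists set0; split => //; last by rewrite measure0 lee_fin mulr_ge0.
      by move=> t [/=]; rewrite eqxx.
    have V0 : 0 < 2 * h ^+ 2 by rewrite mulr_gt0// exprn_gt0.
    have t0 : 0 < h * r by rewrite mulr_gt0.
    apply: unlikelyS (unlikely_row_inner iX (QQ b) il t0 V0).
      by move=> t [].
    rewrite ler_pM2l// ler_expR lerN2.
    have -> : (h * r) ^+ 2 / (2 * (2 * h ^+ 2)) = r ^+ 2 / 4.
      by field; rewrite gt_eqF.
    by rewrite expr2; nra.
  have := unlikely_bigcup UE; rewrite !card_prod !card_ord card_bool.
  apply: unlikelyS => // t [nt]; apply: contra_notP => noE b i l il.
  rewrite leNgt; apply/negP => lt; apply: noE; exists (i, l, b); split => //=.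
  by split; [exact: ltW|exact: norms_ip].
(* The mesh 1/p^4 = h^-8 is fine enough for both nets below, and still costs only about log p per
   coordinate. *)
have N0 : (0 < p ^ 4)%N by rewrite expn_gt0 p0.
have NE : (p ^ 4)%:R = h ^+ 8 :> R by rewrite natrX ph -exprM.
have hh : 400 * (h ^+ 6 * r ^+ 90) <= h ^+ 8.
  have -> : h ^+ 8 = h ^+ 6 * (h * h) by ring.
  rewrite mulrCA ler_pM2l ?exprn_gt0//.
  by apply: le_trans hbig _; rewrite ler_peMl; lra.
(* Both tails below have exponent h^2 r^44 / 2, which beats the entropy of a pair of grid vectors
   with at most h^2 r^40 coordinates each. *)
have count : (h ^+ 2 * r ^+ 40 + h ^+ 2 * r ^+ 40) * r + r <= h ^+ 2 * r ^+ 44 / 2.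
  have -> : h ^+ 2 * r ^+ 44 / 2 = (h ^+ 2 * r ^+ 41) * (r ^+ 3 / 2) by field.
  have -> : (h ^+ 2 * r ^+ 40 + h ^+ 2 * r ^+ 40) * r = (h ^+ 2 * r ^+ 41) * 2.
    by ring.
  have c1 : r <= h ^+ 2 * r ^+ 41.
    rewrite -[leLHS]mul1r ler_pM ?(ltW r0)//; first by rewrite exprn_ege1//; lra.
    by have := rX 1 41 isT; rewrite expr1.
  have c2 : 3 <= r ^+ 3 / 2.
    rewrite ler_pdivlMr//; apply: (@le_trans _ _ (4 ^+ 3)); last first.
      by rewrite lerXn2r ?nnegrE//; lra.
    by rewrite -natrX -natrM ler_nat.
  have c3 : 0 <= h ^+ 2 * r ^+ 41 by rewrite mulr_ge0// exprn_ge0// ltW.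
  by have := ler_wpM2l c3 c2; lra.
have U3 : unlikely P [set t | norms t /\ ~ form t] (expR (- r)).
  have tau0 : 0 < h * r ^+ 22 by rewrite mulr_gt0// exprn_gt0.
  have := @unlikely_bilinear _ _ _ P _ _ (fun i j t => X (i, j) t)
    [set t | norms t] (2 * h ^+ 2) (h * r ^+ 22)
    (expR (- ((h * r ^+ 22) ^+ 2 / 2))) (p ^ 4) N0 (expR_ge0 _).
  rewrite !card_ord NE ph => H.
  have {}H := H _ _ _.
  apply: unlikelyS (H _ _ _) => //.
  - apply: net_count_le => //; rewrite natrD ph.
    have -> : (h * r ^+ 22) ^+ 2 / 2 = h ^+ 2 * r ^+ 44 / 2 by ring.
    apply: le_trans count; rewrite lerD2r ler_pM2r//; apply: lerD => //.
    by rewrite ler_peMr// exprn_ge0// ltW.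
  - have -> : 2 * (2 * h ^+ 2) * k%:R * h ^+ 2 = 4 * h ^+ 4 * k%:R by ring.
    apply: (@le_trans _ _ (4 * h ^+ 4 * (h ^+ 2 * r ^+ 40))).
      by rewrite ler_wpM2l// mulr_ge0// exprn_ge0// ltW.
    apply: le_trans hh.
    have -> : 4 * h ^+ 4 * (h ^+ 2 * r ^+ 40) = 4 * (h ^+ 6 * r ^+ 40) by ring.
    have : h ^+ 6 * r ^+ 40 <= h ^+ 6 * r ^+ 90 by rewrite ler_pM2l ?exprn_gt0// rX.
    have : 0 <= h ^+ 6 * r ^+ 40 by rewrite mulr_ge0// exprn_ge0// ltW.
    by lra.
  - move=> t nt i j.
    have [b Qj] : exists b, QQ b j.
      by have [Qj|Qj] := boolP (Q j); [exists true|exists false].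
    have := sum_sqr_bound (fun s => X (i, s) t) Qj.
    move=> /le_trans/(_ (norms_ip t b i nt)) x2.
    have h2 : 2 * h ^+ 2 <= (2 * h ^+ 2) ^+ 2.
      have : 1 <= h ^+ 2 by rewrite exprn_ege1//; lra.
      by move=> ?; rewrite [leRHS]expr2 ler_peMl; lra.
    rewrite -(@ler_pXn2r _ 2)// ?nnegrE ?mulr_ge0 ?exprn_ge0 ?(ltW h0)//.
    by rewrite real_normK ?num_real//; apply: le_trans x2 h2.
  - move=> u v u1 v1.
    apply: unlikelyS (lexx _) (unlikely_form iX u1 v1 tau0).
    by move=> t [].
have U4 : unlikely P [set t | (inner t /\ form t) /\ ~ tri t] (expR (- r)).
  have tau0 : 0 < h ^+ 3 * r ^+ 46 by rewrite mulr_gt0// exprn_gt0.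
  (* This is (h r^23)^2 (h r)^2: an operator norm bound, with the additive 1 absorbed into an extra
     factor r, times the bound on inner products. *)
  have V0 : 0 < h ^+ 4 * r ^+ 48 by rewrite mulr_gt0// exprn_gt0.
  have := @unlikely_bilinear _ _ _ P _ _ (fun (i l : 'I_k) t => if (i < l)%N then
     ip Q (w t) i l * ip (predC Q) (w t) i l else 0)
    [set t | inner t /\ form t] (h ^+ 2 * r ^+ 2) (h ^+ 3 * r ^+ 46)
    (expR (- ((h ^+ 3 * r ^+ 46) ^+ 2 / (2 * (h ^+ 4 * r ^+ 48)))))
    (p ^ 4) N0 (expR_ge0 _).
  rewrite !card_ord NE => H.
  apply: unlikelyS (H _ _ _) => //.
  - apply: net_count_le => //; rewrite natrD.
    have -> : (h ^+ 3 * r ^+ 46) ^+ 2 / (2 * (h ^+ 4 * r ^+ 48)) =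
       h ^+ 2 * r ^+ 44 / 2 by field; rewrite !gt_eqF.
    by apply: le_trans count; rewrite lerD2r ler_pM2r//; apply: lerD.
  - apply: (@le_trans _ _ (2 * (h ^+ 2 * r ^+ 2) * (h ^+ 2 * r ^+ 40) *
        (h ^+ 2 * r ^+ 40))).
      have c0 : 0 <= 2 * (h ^+ 2 * r ^+ 2).
        by rewrite mulr_ge0// mulr_ge0// sqr_ge0.
      by apply: ler_pM => //; [rewrite mulr_ge0|exact: ler_wpM2l].
    apply: le_trans hh.
    have -> : 2 * (h ^+ 2 * r ^+ 2) * (h ^+ 2 * r ^+ 40) * (h ^+ 2 * r ^+ 40) =
      2 * (h ^+ 6 * r ^+ 82) by ring.
    have : h ^+ 6 * r ^+ 82 <= h ^+ 6 * r ^+ 90 by rewrite ler_pM2l ?exprn_gt0// rX.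
    have : 0 <= h ^+ 6 * r ^+ 82 by rewrite mulr_ge0// exprn_ge0// ltW.
    by lra.
  - move=> t [it _] i l; case: ifPn => il; last first.
      by rewrite normr0 mulr_ge0// exprn_ge0// ltW.
    have il' : i != l by apply: contraTneq il => ->; rewrite ltnn.
    have -> : h ^+ 2 * r ^+ 2 = (h * r) * (h * r) by ring.
    by rewrite normrM ler_pM//; [exact: (it true)|exact: (it false)].
  - move=> u v u1 v1.
    have QC j : predC Q j -> ~~ Q j by [].
    apply: unlikelyS (lexx _) (unlikely_triangular_form iX u v QC tau0 V0).
    move=> t [[it ft] ht]; split => //.
    apply: le_trans (triangular_variance _ _ ft (it true) u1 v1) _.
      exact: sqr_ge0.
    have -> : h ^+ 4 * r ^+ 48 = (h * r ^+ 23) ^+ 2 * (h * r) ^+ 2 by ring.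
    have hr22 : 1 <= h * r ^+ 22 by rewrite -[leLHS]mulr1 ler_pM//; lra.
    rewrite ler_wpM2r ?sqr_ge0// lerXn2r ?nnegrE//.
    + by lra.
    + by rewrite mulr_ge0// ?exprn_ge0// ltW.
    + have -> : h * r ^+ 23 = r * (h * r ^+ 22) by ring.
      by nra.
apply: unlikelyS (lexx _) (unlikelyU (unlikelyU (unlikelyU U1 U2) U3) U4).
move=> t /= nt.
have [n1|n1] := pselect (norms t); last by left; left; left.
have [n2|n2] := pselect (inner t); last by left; left; right.
have [n3|n3] := pselect (form t); last by left; right.
by right; split => // n4; apply: nt; split.
Qed.

(** * Asymptotic comparisons in p *)

Lemma powR_unbounded (R : realType) (a M : R) : 0 < a ->
  exists p0 : nat, forall p : nat, (p0 <= p)%N -> M <= p%:R `^ a.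
Proof.
move=> a0; pose B := Num.max 1 M.
have B0 : 0 < B by rewrite lt_max ltr01.
exists (Num.bound (B `^ a^-1)) => p pb.
apply: (@le_trans _ _ B); first by rewrite le_max lexx orbT.
have B1 : B `^ a^-1 <= p%:R.
  apply: (@le_trans _ _ (Num.bound (B `^ a^-1))%:R); last by rewrite ler_nat.
  by apply: ltW; apply: le_lt_trans (archi_boundP (powR_ge0 _ _)).
have -> : B = (B `^ a^-1) `^ a by rewrite -powRrM mulVf ?gt_eqF// powRr1// ltW.
by apply: ge0_ler_powR; rewrite ?nnegrE ?powR_ge0// ltW.
Qed.

(** With y = p^(b/2), the inequality 1 + x <= e^x gives (b/2) ln p <= y, and y eventually exceeds
    |a|/(b/2); the product of the two bounds is y^2 = p^b. *)
Lemma powR_le_expR (R : realType) (a b : R) : 0 < b ->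
  exists p0 : nat, forall p : nat, (p0 <= p)%N ->
    p%:R `^ a <= expR (p%:R `^ b).
Proof.
move=> b0.
have [p1 p1P] := @powR_unbounded R (b / 2) (`|a| / (b / 2)) (divr_gt0 b0 (ltr0Sn _ 1)).
exists (maxn 1 p1) => p; rewrite geq_max => /andP[pp0 /p1P yM].
have pR0 : (0 : R) < p%:R by rewrite ltr0n.
have pR1 : (1 : R) <= p%:R by rewrite ler1n.
have ln0 : 0 <= ln (p%:R : R) by exact: ln_ge0.
set y := p%:R `^ (b / 2) in yM *.
have y0 : 0 <= y by exact: powR_ge0.
have -> : p%:R `^ b = y * y.
  by rewrite -powRD ?pR0 ?gt_eqF ?implybT// -splitr.
rewrite [leLHS]/powR gt_eqF// ler_expR.
have lny : b / 2 * ln p%:R <= y.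
  rewrite /y /powR gt_eqF//.
  by apply: le_trans (expR_ge1Dx _); rewrite lerDr.
apply: (@le_trans _ _ (`|a| * ln p%:R)); first by rewrite ler_wpM2r// ler_norm.
have -> : `|a| * ln p%:R = `|a| / (b / 2) * (b / 2 * ln p%:R).
  by field; rewrite gt_eqF.
apply: ler_pM => //; last by rewrite mulr_ge0// divr_ge0// ltW.
by rewrite divr_ge0// divr_ge0// ltW.
Qed.

Lemma card_ord_lt (p m : nat) : (m <= p)%N ->
  #|[pred j : 'I_p | (j < m)%N]| = m.
Proof.
move=> mp; rewrite -sum1_card (eq_bigl (fun j : 'I_p => (j < m)%N))//.
by rewrite (big_ord_narrow mp)/= sum1_card card_ord.
Qed.

Lemma half_approx (R : realType) (p : nat) : `|p./2%:R - p%:R / 2 : R| <= 1.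
Proof.
have -> : p%:R = (odd p)%:R + 2 * p./2%:R :> R.
  by rewrite -natrM -natrD mul2n odd_double_half.
by case: (odd p) => /=; rewrite ler_norml; apply/andP; split; lra.
Qed.

(** There are O(k^2) bad events with k^2 <= p^4, so six spare powers of p cover their number and the
    constants. *)
Lemma total_failure_le (R : realType) (k p : nat) (D e : R) :
  (4 <= p)%N -> k%:R <= p%:R ^+ 2 :> R ->
  e <= p%:R `^ (- (D + 6)) -> 0 <= e ->
  (k * 2)%:R * (2 * e) + (k * k * 2)%:R * (2 * e) + e + e +
    k%:R * p%:R `^ (- (D + 6)) <= p%:R `^ (- D).
Proof.
move=> p4 kp ee e0.
have pR4 : (4 : R) <= p%:R by rewrite ler_nat.
have pR0 : (0 : R) < p%:R by lra.
have -> : p%:R `^ (- D) = p%:R ^+ 6 * p%:R `^ (- (D + 6)).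
  rewrite -powR_mulrn ?ltW// -powRD; last by rewrite (gt_eqF pR0) implybT.
  by congr (_ `^ _); lra.
set f := p%:R `^ (- (D + 6)) in ee *.
have f0 : 0 <= f by exact: powR_ge0.
set x : R := p%:R in pR4 pR0 kp *.
have k0 : (0 : R) <= k%:R by [].
have x2 : 16 <= x ^+ 2 by rewrite expr2; nra.
have kk : (k * k)%:R <= x ^+ 4 :> R.
  have -> : x ^+ 4 = x ^+ 2 * x ^+ 2 by rewrite -exprD.
  by rewrite natrM ler_pM.
have x4 : 16 * x ^+ 2 <= x ^+ 4.
  have -> : x ^+ 4 = x ^+ 2 * x ^+ 2 by rewrite -exprD.
  by rewrite ler_wpM2r ?sqr_ge0.
have x6 : 16 * x ^+ 4 <= x ^+ 6.
  have -> : x ^+ 6 = x ^+ 2 * x ^+ 4 by rewrite -exprD.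
  by rewrite ler_wpM2r// exprn_ge0// ltW.
rewrite !natrM in kk *.
apply: (@le_trans _ _ ((4 * k%:R + 4 * (k%:R * k%:R) + 2 + k%:R) * f)).
  have c0 : 0 <= 4 * k%:R + 4 * (k%:R * k%:R) + 2 :> R.
    by rewrite !addr_ge0// ?mulr_ge0// mulr_ge0.
  have := ler_wpM2l c0 ee; nra.
by apply: ler_wpM2r => //; lra.
Qed.

(** * Choice of parameters and conclusion *)

Theorem theorem3 (R : realType) (eps : R) (k : nat -> nat)
  (d : measure_display) (T : nat -> measurableType d)
  (P : forall p : nat, probability (T p) R)
  (w : forall p : nat, 'I_(k p) -> T p -> 'cV[R]_p)
  (pi : forall p : nat, 'I_(k p) -> T p -> R) :
  0 < eps ->
  (exists p0 : nat, forall p : nat, (p0 <= p)%N ->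
     (k p)%:R <= (p%:R) `^ (6 / 5 - eps)) ->
  (* the coordinates w_i(j), i < k, j < p, are i.i.d. N(0,1) *)
  (forall p : nat,
     mutually_independent (P p)
       (fun ij : 'I_(k p) * 'I_p => fun t => w p ij.1 t ij.2 0) /\
     (forall (i : 'I_(k p)) (j : 'I_p),
        std_normal_rv (P p) (fun t => w p i t j 0))) ->
  (* each pi_i is a random variable ... *)
  (forall p (i : 'I_(k p)), measurable_fun setT (pi p i)) ->
  (* ... with |1/pi_i^2 - 1| <= p^(-1/2+delta) w.v.h.p., uniformly in i *)
  (forall delta : R, 0 < delta -> forall D : R, 0 < D ->
     exists p0 : nat, forall p : nat, (p0 <= p)%N -> forall i : 'I_(k p),
       holds_with_prob (P p)
         [set t | `|(pi p i t ^+ 2)^-1 - 1| <= (p%:R) `^ (- (1 / 2) + delta)]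
         (1 - (p%:R) `^ (- D))) ->
  (* conclusion: w.v.h.p. an ellipsoid passes through v_i = pi_i w_i *)
  forall D : R, 0 < D ->
    exists p0 : nat, forall p : nat, (p0 <= p)%N ->
      holds_with_prob (P p)
        [set t | exists Y : 'M[R]_p, psd Y /\
           forall i : 'I_(k p),
             let v := pi p i t *: w p i t in (v^T *m Y *m v) 0 0 = 1]
        (1 - (p%:R) `^ (- D)).
Proof.
move=> eps0 [pk kP] wN mpi piP D D0.
have a0 : (0 : R) < 1 / 200 by lra.
have [pr prP] := @powR_unbounded R (1 / 200) 4 a0.
have [pe peP] := @powR_le_expR R (D + 6) (1 / 200) a0.
have [pg pgP] := @powR_le_expR R 6 (1 / 200) a0.
have d0 : (0 : R) < 1 / 100 by lra.
have D60 : 0 < D + 6 by lra.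
have [pp ppP] := piP (1 / 100) d0 (D + 6) D60.
exists (maxn 4 (maxn pk (maxn pr (maxn pe (maxn pg pp))))) => p.
rewrite !geq_max => /and5P[p4 /kP kp /prP r4 /peP ep /andP[/pgP gp /ppP pip]].
have pR4 : (4 : R) <= p%:R by rewrite ler_nat.
have pR0 : (0 : R) < p%:R by lra.
(* All exponents become integer powers of [r]: p = r^200, its square root is r^100, and p^(6/5) =
   r^240 = h^2 r^40. *)
pose r : R := p%:R `^ (1 / 200).
pose h := r ^+ 100.
have r1 : 1 <= r by apply: le_trans r4; lra.
have r0 : 0 < r by lra.
have rX n : r ^+ n = p%:R `^ (n%:R / 200).
  by rewrite -powR_mulrn ?(ltW r0)// /r -powRrM; congr (_ `^ _); lra.
have ph : p%:R = h ^+ 2.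
  by rewrite /h -exprM rX -[LHS]powRr1 ?(ltW pR0)//; congr (_ `^ _); lra.
have kh : (k p)%:R <= h ^+ 2 * r ^+ 40.
  apply: le_trans kp _; rewrite /h -exprM -exprD rX.
  by apply: ler_powR; [lra|rewrite natrD natrM; lra].
have hbig : 400 * r ^+ 90 <= h.
  have -> : h = r ^+ 10 * r ^+ 90 by rewrite -exprD.
  rewrite ler_pM2r ?exprn_gt0//; apply: (@le_trans _ _ (4 ^+ 5)).
    by rewrite -natrX ler_nat.
  apply: (@le_trans _ _ (r ^+ 5)); first by rewrite lerXn2r ?nnegrE// ltW.
  exact: ler_weXn2l.
have kp2 : (k p)%:R <= p%:R ^+ 2 :> R.
  apply: le_trans kp _; rewrite -powR_mulrn ?(ltW pR0)//.
  by apply: ler_powR; lra.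
(* Since p >= 4, 2 (p^4 + 1) <= 16 p^4 <= p^6, which is eventually below e^r. *)
have grid : (2 * (p ^ 4).+1)%:R <= expR r.
  apply: le_trans gp; rewrite powR_mulrn ?(ltW pR0)// -natrX ler_nat.
  rewrite (_ : p ^ 6 = p * p * p ^ 4)%N; last by rewrite -mulnA -!expnS.
  apply: (@leq_trans (16 * p ^ 4)); last first.
    by rewrite leq_mul2r (leq_mul p4 p4) orbT.
  have q0 : (0 < p ^ 4)%N by rewrite expn_gt0 (leq_trans _ p4).
  rewrite -[(p ^ 4).+1]addn1 mulnDr muln1 (@leq_trans (2 * p ^ 4 + 2 * p ^ 4))//.
    by rewrite leq_add2l leq_pmulr.
  by rewrite -mulnDl leq_mul2r orbT.
have ee : expR (- r) <= p%:R `^ (- (D + 6)).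
  by rewrite expRN powRN lef_pV2 ?posrE ?expR_gt0 ?powR_gt0.
pose X (a : 'I_(k p) * 'I_p) t := w p a.1 t a.2 0.
have iX : iid_normal (P p) X.
  by have [h1 h2] := wN p; split => // -[i j]; exact: h2.
pose Q : pred 'I_p := [pred j : 'I_p | (j < p./2)%N].
have U1 := typical_whp Q iX r4 hbig ph kh grid.
have U2 : unlikely (P p) [set t | exists i : 'I_(k p),
    ~ `|(pi p i t ^+ 2)^-1 - 1| <= p%:R `^ (- (1 / 2) + 1 / 100)]
    ((k p)%:R * p%:R `^ (- (D + 6))).
  rewrite -[in X in unlikely _ _ X](card_ord (k p)).
  apply: unlikely_bigcup => i.
  have [A [mA AE PA]] := pip i; exists (~` A); split.
  - exact: measurableC.
  - by move=> t /= nt At; apply: nt; exact: AE.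
  - rewrite probability_setC//; move: PA.
    rewrite -(fineK (fin_num_measure (P p) _ mA)) -EFinB !lee_fin; lra.
have [B [mB BE PB]] := unlikelyU U1 U2.
exists (~` B); split; first exact: measurableC.
  move=> t /= nB.
  have [ty|nty] := pselect (typical Q r h (fun a => X a t)); last first.
    by exfalso; apply: nB; apply: BE; left.
  have pit i : `|(pi p i t ^+ 2)^-1 - 1| <= r ^+ 2 / h.
    (* The choice delta = 1/100 makes the allowed deviation exactly r^2 / h. *)
    have -> : r ^+ 2 / h = p%:R `^ (- (1 / 2) + 1 / 100).
      rewrite rX /h rX -powRN -powRD ?(gt_eqF pR0) ?implybT//.
      by congr (_ `^ _); lra.
    by apply: contrapT => npi; apply: nB; apply: BE; right; exists i.
  case: ty => nrm inn frm tri.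
  have cQ : `|#|Q|%:R - p%:R / 2 : R| <= 1.
    rewrite card_ord_lt; last by rewrite -[leqRHS]odd_double_half -addnn addnA leq_addl.
    exact: half_approx.
  have [Y [psdY YE]] := fit_of_bounds r4 hbig ph kh cQ (nrm true) (nrm false)
    (inn true) (inn false) frm tri pit.
  exists Y; split => // i.
  (* The inverse of 0 is 0, so pi_i = 0 would give a deviation of 1, larger than r^2 / h. *)
  have pi0 : pi p i t != 0.
    apply: contraTneq (pit i) => ->; rewrite expr0n/= invr0 sub0r normrN1 -ltNge.
    rewrite ltr_pdivrMr ?exprn_gt0// mul1r.
    have : r ^+ 2 <= r ^+ 90 by exact: ler_weXn2l.
    have : 0 < r ^+ 90 by exact: exprn_gt0.
    lra.
  have xE : \col_s X (i, s) t = w p i t.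
    by apply/colP => s; rewrite mxE.
  have := YE i; rewrite /= xE => YEi.
  have scE a (M : 'M[R]_1) : (a *: M) 0 0 = a * M 0 0 by rewrite mxE.
  have trZ : (pi p i t *: w p i t)^T = pi p i t *: (w p i t)^T by rewrite linearZ.
  (* The fitted value at w_i is 1/pi_i^2, and scaling w_i by pi_i multiplies it by pi_i^2. *)
  rewrite /= trZ -!scalemxAl -scalemxAr !scE YEi.
  by field.
rewrite probability_setC//; move: PB.
have := total_failure_le p4 kp2 ee (expR_ge0 _).
rewrite -(fineK (fin_num_measure (P p) _ mB)) -EFinB !lee_fin; lra.
Qed.
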